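(* Let $k$ be a field and let $\mathcal A$ be a finite set of hyperplanes through the origin in $\mathbb R^d$, with face semigroup $\mathcal F$, intersection lattice $\mathcal L$ and face semigroup algebra $k\mathcal F$. Let $\mathcal Q$ be the quiver with vertex set $\mathcal L$ and exactly one arrow $X\to Y$ for each cover relation $X\gtrdot Y$ in $\mathcal L$, and let $\varphi:k\mathcal Q\to k\mathcal F$ be the $k$-algebra morphism determined by $\varphi(X)=e_X$ for vertices $X$ and $\varphi(X\to Y)=e_Y\,\partial(y)\,e_X$ for arrows $X\to Y$, where $y$ is the face of support $Y$ chosen in the construction of $e_Y$. For each interval $[Z,X]$ of length two in $\mathcal L$, the sum of all paths of length two from $X$ to $Z$, $$\sum_{Y\in(Z,X)}(X\to Y\to Z),$$ is an element of the kernel of $\varphi$. These elements form a minimal generating set of relations for the kernel of $\varphi$ (as a two-sided ideal of $k\mathcal Q$).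
   Context: For each $H\in\mathcal A$ fix a labelling $H^+,H^-$ of the two open half-spaces determined by $H$, and put $H^0=H$. A face of $\mathcal A$ is a nonempty set of the form $x=\bigcap_{H\in\mathcal A}H^{\sigma_H}$ with $\sigma_H\in\{+,-,0\}$; write $\sigma_H(x)=\sigma_H$. $\mathcal F$ is the set of faces, partially ordered by $x\le y$ iff for each $H$ either $\sigma_H(x)=0$ or $\sigma_H(x)=\sigma_H(y)$. The support of a face is $\operatorname{supp}(x)=\bigcap_{H:\sigma_H(x)=0}H$ (equal to $\mathbb R^d$ if no $\sigma_H(x)$ is $0$). The intersection lattice $\mathcal L=\operatorname{supp}(\mathcal F)$ is ordered by inclusion; $(Z,X)=\{Y\in\mathcal L: Z<Y<X\}$, and the length of an interval is the length of its longest chain. In any poset, $a\gtrdot b$ means $a$ covers $b$. The product $xy$ of faces is the face with $\sigma_H(xy)=\sigma_H(x)$ if $\sigma_H(x)\ne0$ and $\sigma_H(xy)=\sigma_H(y)$ if $\sigma_H(x)=0$. This makes $\mathcal F$ a semigroup with identity $1=\bigcap_{H\in\mathcal A}H$, and $k\mathcal F$ is its semigroup algebra over $k$. Idempotents: for each $X\in\mathcal L$ fix a face $x$ with $\operatorname{supp}(x)=X$ and set recursively $e_X=x-\sum_{Y>X}x\,e_Y$; these form a complete system of primitive orthogonal idempotents of $k\mathcal F$. Incidence numbers: fix an orientation $\epsilon_X$ of every subspace $X\in\mathcal L$ ($\epsilon_X$ assigns to an ordered basis of $X$ the value $+1$ or $-1$ according to its orientation). If $x$ is a codimension one face of $y$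 (i.e. $y\gtrdot x$ in $\mathcal F$), pick a positively oriented basis $(e_1,\dots,e_i)$ of $\operatorname{supp}(x)$ and a vector $v\in y$, and put $[x:y]=\epsilon_{\operatorname{supp}(y)}(e_1,\dots,e_i,v)\in\{\pm1\}$ (independent of choices). The linear map $\partial:k\mathcal F\to k\mathcal F$ is $\partial(y)=\sum_{x\in\mathcal F,\ x\gtrdot y}[y:x]\,x$ for $y\in\mathcal F$. Path algebra: $k\mathcal Q$ is the $k$-vector space spanned by the paths in $\mathcal Q$ (including the vertices as paths of length $0$), and the product $p\cdot q$ is the path ''first $q$, then $p$'' if $p$ starts where $q$ ends, and $0$ otherwise. Thus $\varphi(X_0\to X_1\to\cdots\to X_r)=\varphi(X_{r-1}\to X_r)\cdots\varphi(X_0\to X_1)$. A relation in an ideal $I\subset k\mathcal Q$ is an element of $I$ that is a $k$-linear combination of paths all starting at one vertex and all ending at one vertex. *)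

(* Defs.v *)
From HB Require Import structures.
From mathcomp Require Import all_boot all_order all_algebra.
From mathcomp Require Import boolp classical_sets reals.
From mathcomp Require Import finmap monalg.

Set Implicit Arguments.
Unset Strict Implicit.
Unset Printing Implicit Defensive.

Import Order.TTheory GRing.Theory Num.Theory.

Local Open Scope ring_scope.

Section Poset.
Context {disp : Order.disp_t} {T : finPOrderType disp}.

Definition covers (a b : T) : bool :=
  (b < a)%O && ~~ [exists c : T, (b < c < a)%O].

Definition chain (C : {set T}) : bool :=
  [forall a in C, forall b in C, (a >=< b)%O].

(* Length of [[z, x]]: a chain with [m] elements has length [m - 1].          *)
Definition interval_length (z x : T) : nat :=
  \max_(C : {set T} | chain C && (C \subset [set y | (z <= y <= x)%O])) #|C|.-1.

End Poset.

(* Path algebra of the quiver with vertex set [V] and exactly one arrow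
    [a -> b] whenever [e a b]. As there is at most one arrow between two
    vertices, a path is determined by the sequence of vertices it visits:
    [(v, s)] stands for [v -> s_0 -> s_1 -> ...]. *)

Section PathAlgebra.
Context {V : finType} (e : rel V).

Record qpath := QPath {
  qval :> V * seq V;
  _ : path e qval.1 qval.2
}.
HB.instance Definition _ := [isSub for qval].
HB.instance Definition _ := [Choice of qpath by <:].

Definition qsrc (p : qpath) : V := p.1.
Definition qtgt (p : qpath) : V := last p.1 p.2.

(* First [q], then [p].                                                       *)
Definition qcomp (p q : qpath) : option qpath :=
  if qsrc p == qtgt q then insub (q.1, q.2 ++ p.2) else None.

Lemma qcompP (p q : qpath) :
  if qcomp p q is Some r then
    [/\ qsrc p = qtgt q, r.1 = q.1 & r.2 = q.2 ++ p.2]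
  else qsrc p <> qtgt q.
Proof.
rewrite /qcomp; case: eqP => // pq; case: insubP => [r _ ->|] //=.
move: (valP p) (valP q); rewrite /= cat_path => hp hq.
by rewrite hq -/(qtgt q) -pq hp.
Qed.

Lemma qcomp_some (p q r : qpath) :
  qsrc p = qtgt q -> r.1 = q.1 -> r.2 = q.2 ++ p.2 -> qcomp p q = Some r.
Proof.
move=> pq r1 r2; have := qcompP p q; case: qcomp => // s [_ s1 s2].
congr Some; apply: val_inj => /=.
by rewrite [qval s]surjective_pairing [qval r]surjective_pairing r1 r2 s1 s2.
Qed.

Lemma qcompA (p q r : qpath) :
  obind (fun s => qcomp s r) (qcomp p q) = obind (qcomp p) (qcomp q r).
Proof.
have := qcompP p q; case pq: (qcomp p q) => [s|] /=.
  case=> srcp s1 s2; have := qcompP q r; case qr: (qcomp q r) => [t|] /=.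
    case=> srcq t1 t2; have := qcompP p t; case: (qcomp p t) => [w|].
      case=> _ w1 w2; apply: qcomp_some.
      - by rewrite -srcq /qsrc s1.
      - by rewrite w1 t1.
      - by rewrite w2 t2 s2 catA.
    by case; rewrite srcp /qtgt t2 t1 last_cat -/(qtgt r) -srcq.
  move=> nqr; have := qcompP s r; case: (qcomp s r) => // w [h].
  by case: nqr; rewrite -h /qsrc s1.
move=> npq; have := qcompP q r; case qr: (qcomp q r) => [t|] //= [srcq t1 t2].
have := qcompP p t; case: (qcomp p t) => // w [h].
by case: npq; rewrite h /qtgt t2 t1 last_cat -/(qtgt r) -srcq.
Qed.

Definition qvertex (v : V) : qpath := @QPath (v, [::]) isT.

Lemma qcomp_vl (v : V) (p : qpath) :
  qcomp (qvertex v) p = if v == qtgt p then Some p else None.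
Proof.
case: eqP => h; first by apply: qcomp_some; rewrite ?cats0.
by have := qcompP (qvertex v) p; case: qcomp => // r [].
Qed.

Lemma qcomp_vr (v : V) (p : qpath) :
  qcomp p (qvertex v) = if v == qsrc p then Some p else None.
Proof.
case: eqP => h; first by apply: qcomp_some.
by have := qcompP p (qvertex v); case: qcomp => // r [] /esym.
Qed.

Context (k : comNzRingType).

Definition pathalg : predArgType := {malg k[qpath]}.
HB.instance Definition _ := GRing.Lmodule.on pathalg.

(* The basis vector of a path, scaled by [c]; [None] stands for [0].          *)
Definition pbasis (c : k) (o : option qpath) : pathalg :=
  if o is Some p then << c *g p >> else 0.

(* Locked, as unfolding products stalls unification.                          *)
Fact pamul_key : unit. Proof. exact: tt. Qed.
Definition pamul : pathalg -> pathalg -> pathalg :=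
  locked_with pamul_key (fun u v =>
    \sum_(p <- msupp u) \sum_(q <- msupp v) pbasis (u@_p * v@_q) (qcomp p q)).

Lemma pamulE u v : pamul u v =
  \sum_(p <- msupp u) \sum_(q <- msupp v) pbasis (u@_p * v@_q) (qcomp p q).
Proof. by rewrite /pamul unlock. Qed.

Definition paone : pathalg := \sum_(v : V) pbasis 1 (Some (qvertex v)).

Lemma pbasis0 o : pbasis 0 o = 0.
Proof. by case: o => //= p; rewrite monalgU0. Qed.

Lemma pbasisD c c' o : pbasis (c + c') o = pbasis c o + pbasis c' o.
Proof. by case: o => [p|] /=; rewrite ?addr0 // monalgUD. Qed.

Lemma pamulw (d1 d2 : {fset qpath}) (u v : pathalg) :
  (msupp u `<=` d1)%fset -> (msupp v `<=` d2)%fset ->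
  pamul u v = \sum_(p <- d1) \sum_(q <- d2) pbasis (u@_p * v@_q) (qcomp p q).
Proof.
move=> le_d1 le_d2; rewrite pamulE (big_fset_incl _ le_d1) /=.
  apply/eq_bigr=> p _; apply/big_fset_incl => // q _ /mcoeff_outdom ->.
  by rewrite mulr0 pbasis0.
move=> p _ /mcoeff_outdom up.
by rewrite big1 // => q _; rewrite up mul0r pbasis0.
Qed.

Lemma pamulDl : left_distributive pamul +%R.
Proof.
move=> u1 u2 v.
rewrite [in RHS](pamulw (fsubsetUl _ (msupp u2)) (fsubset_refl _)).
rewrite [in RHS](pamulw (fsubsetUr (msupp u1) _) (fsubset_refl _)).
rewrite (pamulw (msuppD_le _ _) (fsubset_refl _)) -big_split /=.
apply/eq_bigr=> p _; rewrite -big_split /=; apply/eq_bigr=> q _.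
by rewrite mcoeffD mulrDl pbasisD.
Qed.

Lemma pamulDr : right_distributive pamul +%R.
Proof.
move=> v u1 u2.
rewrite [in RHS](pamulw (fsubset_refl _) (fsubsetUl _ (msupp u2))).
rewrite [in RHS](pamulw (fsubset_refl _) (fsubsetUr (msupp u1) _)).
rewrite (pamulw (fsubset_refl _) (msuppD_le _ _)) -big_split /=.
apply/eq_bigr=> p _; rewrite -big_split /=; apply/eq_bigr=> q _.
by rewrite mcoeffD mulrDr pbasisD.
Qed.

Lemma pamul0l : left_zero 0 pamul.
Proof. by move=> u; rewrite pamulE msupp0 big_seq_fset0. Qed.

Lemma pamul0r : right_zero 0 pamul.
Proof. by move=> u; rewrite pamulE msupp0 big1 // => p _; rewrite big_seq_fset0. Qed.

Lemma pamulUU c c' (p q : qpath) :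
  pamul << c *g p >> << c' *g q >> = pbasis (c * c') (qcomp p q).
Proof. by rewrite (pamulw msuppU_le msuppU_le) !big_seq_fset1 !mcoeffUU. Qed.

Lemma pamulbl c c' o (q : qpath) :
  pamul (pbasis c o) << c' *g q >> = pbasis (c * c') (obind (qcomp^~ q) o).
Proof. by case: o => [p|] /=; rewrite ?pamulUU // pamul0l. Qed.

Lemma pamulbr c c' o (q : qpath) :
  pamul << c *g q >> (pbasis c' o) = pbasis (c * c') (obind (qcomp q) o).
Proof. by case: o => [p|] /=; rewrite ?pamulUU // pamul0r. Qed.

Lemma pamul_suml I (s : seq I) P (F : I -> pathalg) v :
  pamul (\sum_(i <- s | P i) F i) v = \sum_(i <- s | P i) pamul (F i) v.
Proof. exact: (big_morph (pamul^~ v) (fun _ _ => pamulDl _ _ _) (pamul0l _)). Qed.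

Lemma pamul_sumr I (s : seq I) P (F : I -> pathalg) v :
  pamul v (\sum_(i <- s | P i) F i) = \sum_(i <- s | P i) pamul v (F i).
Proof. exact: (big_morph (pamul v) (fun _ _ => pamulDr _ _ _) (pamul0r _)). Qed.

Lemma pamulA : associative pamul.
Proof.
move=> u v w; rewrite [u]monalgE.
rewrite (pamul_suml _ _ _ (pamul v w)) (pamul_suml _ _ _ v) pamul_suml.
apply: eq_bigr => p _; rewrite [v]monalgE.
rewrite (pamul_suml _ _ _ w) (pamul_sumr _ _ _ << _ *g p >>).
rewrite (pamul_sumr _ _ _ << _ *g p >>) pamul_suml; apply: eq_bigr => q _.
rewrite [w]monalgE (pamul_sumr _ _ _ << _ *g q >>) !pamul_sumr.
apply: eq_bigr => r _.
by rewrite !pamulUU pamulbl pamulbr mulrA qcompA.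
Qed.

Lemma pamul1l : left_id paone pamul.
Proof.
move=> u; rewrite [in LHS](monalgE u) pamul_sumr [RHS]monalgE.
apply: eq_bigr => p _; rewrite /paone pamul_suml (bigD1 (qtgt p)) //=.
rewrite pamulUU qcomp_vl eqxx mul1r big1 ?addr0 // => v vp.
by rewrite pamulUU qcomp_vl (negPf vp).
Qed.

Lemma pamul1r : right_id paone pamul.
Proof.
move=> u; rewrite [in LHS](monalgE u) pamul_suml [RHS]monalgE.
apply: eq_bigr => p _; rewrite /paone pamul_sumr (bigD1 (qsrc p)) //=.
rewrite pamulUU qcomp_vr eqxx mulr1 big1 ?addr0 // => v vp.
by rewrite pamulUU qcomp_vr (negPf vp).
Qed.

HB.instance Definition _ := GRing.Zmodule_isPzRing.Build pathalg
  pamulA pamul1l pamul1r pamulDl pamulDr.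

Lemma pathalg_scaleAl (c : k) (u v : pathalg) : c *: (u * v) = (c *: u) * v.
Proof.
have le : (msupp (c *: u : {malg k[qpath]}) `<=` msupp u)%fset by exact: msuppZ_le.
rewrite -[RHS]/(pamul _ _) (pamulw le (fsubset_refl _)).
rewrite -[u * v]/(pamul u v) pamulE scaler_sumr.
apply: eq_bigr => p _; rewrite scaler_sumr; apply: eq_bigr => q _.
rewrite mcoeffZ -mulrA; case: (qcomp p q) => [r|] /=; last by rewrite scaler0.
by apply/malgP => s; rewrite mcoeffZ !mcoeffU mulrnAr.
Qed.

Lemma paone_neq0 (v : V) : (1 : pathalg) != 0.
Proof.
apply/eqP => /(congr1 (mcoeff (qvertex v))); rewrite mcoeff0 raddf_sum /=.
rewrite (bigD1 v) //= mcoeffUU big1 ?addr0; first exact/eqP/oner_neq0.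
move=> w wv; rewrite mcoeffU; case: (qvertex w =P _) => // /(congr1 qsrc) h.
by move: wv; rewrite -[w]/(qsrc (qvertex w)) h eqxx.
Qed.

(* The path [v -> s_0 -> s_1 -> ...] in the path algebra, and [0] if there is
   no such path.                                                              *)
Definition pathelt (v : V) (s : seq V) : pathalg := pbasis 1 (insub (v, s)).

Definition two_sided_ideal (B : pzRingType) (I : set B) : Prop :=
  [/\ I 0, forall u v, I u -> I v -> I (u + v)
    & forall a u b, I u -> I (a * u * b)].

Definition ideal_gen (B : pzRingType) (S : set B) : set B :=
  smallest (@two_sided_ideal B) S.

Definition relations (I : set pathalg) : set pathalg :=
  [set u | I u /\ exists x y : V,
     forall p : qpath, p \in msupp u -> qsrc p = x /\ qtgt p = y]%classic.

Definition minimal_generating_relations (I S : set pathalg) : Prop :=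
  [/\ (S `<=` relations I)%classic, ideal_gen S = I
    & forall S' : set pathalg, (S' `<` S)%classic -> ideal_gen S' <> I].

End PathAlgebra.

(* A finite set of linear hyperplanes of [R^d], together with the labelling of
   their open half-spaces: the [i]-th hyperplane is the kernel of
   [v |-> v *m hnormal i], which is positive on [H_i^+] and negative on
   [H_i^-].                                                                   *)
Definition hyperplane_of (R : realType) (d : nat) (a : 'cV[R]_d) :
    {vspace 'rV[R]_d} :=
  lker (linfun (fun v : 'rV[R]_d => v *m a)).

Record arrangement (R : realType) (d : nat) := Arrangement {
  hcount : nat;
  hnormal : 'I_hcount -> 'cV[R]_d;
  hnormal_neq0 : forall i, hnormal i != 0;
  hyperplane_inj : injective (fun i => hyperplane_of (hnormal i))
}.

Section Faces.
Context {R : realType} {d : nat} (A : arrangement R d).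

Definition hyperplane (i : 'I_(hcount A)) : {vspace 'rV[R]_d} :=
  hyperplane_of (hnormal i).

Definition hform (i : 'I_(hcount A)) (v : 'rV[R]_d) : R := (v *m hnormal i) 0 0.

(* [H_i^s], where [Some true], [Some false], [None] encode [+], [-], [0].      *)
Definition side (i : 'I_(hcount A)) (s : option bool) (v : 'rV[R]_d) : bool :=
  match s with
  | Some true => 0 < hform i v
  | Some false => hform i v < 0
  | None => v \in hyperplane i
  end.

(* A nonempty set determines its signs, so faces are encoded by sign vectors.  *)
Record face := Face {
  fsign :> {ffun 'I_(hcount A) -> option bool};
  _ : `[< exists v : 'rV[R]_d, forall i, side i (fsign i) v >]
}.
HB.instance Definition _ := [isSub for fsign].
HB.instance Definition _ := [Finite of face by <:].

Definition in_face (v : 'rV[R]_d) (x : face) : Prop := forall i, side i (x i) v.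

Definition face_le (x y : face) : bool :=
  [forall i, (x i == None) || (x i == y i)].

Lemma face_le_refl : reflexive face_le.
Proof. by move=> x; apply/forallP => i; rewrite eqxx orbT. Qed.

Lemma face_le_anti : antisymmetric face_le.
Proof.
move=> x y /andP[/forallP xy /forallP yx]; apply/val_inj/ffunP => i /=.
by have /orP[/eqP xi|/eqP //] := xy i; have /orP[/eqP yi|/eqP //] := yx i;
  rewrite xi yi.
Qed.

Lemma face_le_trans : transitive face_le.
Proof.
move=> y x z /forallP xy /forallP yz; apply/forallP => i.
by have /orP[->//|/eqP ->] := xy i.
Qed.

Fact face_display : Order.disp_t. Proof. exact: Order.Disp tt tt. Qed.
HB.instance Definition _ := Order.Le_isPOrder.Build face_display face
  face_le_refl face_le_anti face_le_trans.

Lemma hyperplaneE i v : (v \in hyperplane i) = (hform i v == 0).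
Proof.
have lin : linear (fun v : 'rV[R]_d => v *m hnormal i).
  by move=> c u w; rewrite mulmxDl scalemxAl.
pose L := GRing.isLinear.Build _ _ _ _ (fun v : 'rV[R]_d => v *m hnormal i) lin.
pose F : {linear 'rV[R]_d -> 'M[R]_(1, 1)} :=
  HB.pack (fun v : 'rV[R]_d => v *m hnormal i) L.
rewrite memv_ker (lfunE F) /= /hform.
apply/eqP/eqP => [->|h]; first by rewrite mxE.
by apply/matrixP => a b; rewrite !ord1 h mxE.
Qed.

Lemma hformD i v w : hform i (v + w) = hform i v + hform i w.
Proof. by rewrite /hform mulmxDl mxE. Qed.

Lemma hformZ i c v : hform i (c *: v) = c * hform i v.
Proof. by rewrite /hform -scalemxAl mxE. Qed.

Lemma face_ex (x : face) : exists v, in_face v x.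
Proof. by have /asboolP := valP x. Qed.

Definition sgmul (x y : face) : {ffun 'I_(hcount A) -> option bool} :=
  [ffun i => if x i is None then y i else x i].

Lemma sgmul_face x y : `[< exists v, forall i, side i (sgmul x y i) v >].
Proof.
apply/asboolP; have [v xv] := face_ex x; have [w yw] := face_ex y.
suff [c c0 hc] : exists2 c : R, 0 < c & forall c', 0 < c' -> c' <= c ->
    forall i, i \in enum 'I_(hcount A) -> side i (sgmul x y i) (v + c' *: w).
  by exists (v + c *: w) => i; apply: hc => //; rewrite mem_enum.
elim: (enum _) => [|i s [c c0 hc]]; first by exists 1.
suff [b b0 hb] : exists2 b : R, 0 < b &
    forall c', 0 < c' -> c' <= b -> side i (sgmul x y i) (v + c' *: w).
  exists (Num.min b c); first by rewrite lt_min b0.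
  move=> c' c'0; rewrite le_min => /andP[c'b c'c] j.
  by rewrite inE => /orP[/eqP ->|js]; [apply: hb|apply: hc].
rewrite ffunE; have {xv} := xv i; have {yw} := yw i.
have M0 : 0 < 1 + `|hform i w| by rewrite ltr_pwDl.
have bnd c' : 0 < c' -> c' <= `|hform i v| / (1 + `|hform i w|) ->
    hform i v != 0 -> `|c' * hform i w| < `|hform i v|.
  move=> c'0; rewrite ler_pdivlMr // => h vn0; rewrite normrM gtr0_norm //.
  by apply: lt_le_trans h; rewrite mulrDr mulr1 ltrDr.
have pos : hform i v != 0 -> 0 < `|hform i v| / (1 + `|hform i w|).
  by move=> h; rewrite divr_gt0 // normr_gt0.
case: (x i) => [[]|] /= yw xv.
- have vn0 := lt0r_neq0 xv; exists (`|hform i v| / (1 + `|hform i w|)).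
    exact: pos.
  move=> c' c'0 /(bnd _ c'0)/(_ vn0); rewrite hformD hformZ (gtr0_norm xv).
  by rewrite ltr_norml => /andP[+ _]; rewrite -subr_gt0 opprK addrC.
- have vn0 := ltr0_neq0 xv; exists (`|hform i v| / (1 + `|hform i w|)).
    exact: pos.
  move=> c' c'0 /(bnd _ c'0)/(_ vn0); rewrite hformD hformZ (ltr0_norm xv).
  by rewrite ltr_norml => /andP[_]; rewrite -subr_lt0 opprK addrC.
- exists 1 => // c' c'0 _; move: xv yw; rewrite hyperplaneE => /eqP xv.
  case: (y i) => [[]|] /=; rewrite ?hyperplaneE hformD hformZ xv add0r.
  + by move=> h; rewrite mulr_gt0.
  + by move=> h; rewrite pmulr_rlt0.
  + by move=> /eqP ->; rewrite mulr0.
Qed.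

Definition face_mul (x y : face) : face := Face (sgmul_face x y).

Definition sgone : {ffun 'I_(hcount A) -> option bool} := [ffun=> None].

Lemma sgone_face : `[< exists v, forall i, side i (sgone i) v >].
Proof. by apply/asboolP; exists 0 => i; rewrite ffunE /= mem0v. Qed.

Definition face_one : face := Face sgone_face.

Lemma face_mulE x y i : face_mul x y i = if x i is None then y i else x i.
Proof. exact: ffunE. Qed.

Lemma face_oneE i : face_one i = None.
Proof. exact: ffunE. Qed.

Lemma face_eqP (x y : face) : (forall i, x i = y i) -> x = y.
Proof. by move=> h; apply/val_inj/ffunP. Qed.

Lemma face_mulA : associative face_mul.
Proof. by move=> x y z; apply: face_eqP => i; rewrite !face_mulE; case: (x i). Qed.

Lemma face_mul1l : left_id face_one face_mul.
Proof. by move=> x; apply: face_eqP => i; rewrite face_mulE face_oneE. Qed.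

Lemma face_mul1r : right_id face_one face_mul.
Proof.
by move=> x; apply: face_eqP => i; rewrite face_mulE face_oneE; case: (x i).
Qed.

Lemma face_unit x y : face_mul x y = face_one -> x = face_one /\ y = face_one.
Proof.
move=> h; have {}h i : (if x i is None then y i else x i) = None.
  by rewrite -face_mulE h face_oneE.
by split; apply: face_eqP => i; have := h i; rewrite face_oneE; case: (x i).
Qed.

(* An alias of [face], so that the ring structure of [{malg k[face_monom]}] is
   not inferred on [{malg k[face]}], see [kF_mul].                            *)
Definition face_monom : Type := face.
HB.instance Definition _ := Choice.on face_monom.
HB.instance Definition _ := Choice_isMonomialDef.Build face_monom
  face_mulA face_mul1l face_mul1r face_unit.

Definition supp_space (x : face) : {vspace 'rV[R]_d} :=
  (\bigcap_(i | x i == None) hyperplane i)%VS.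

Definition lattice : predArgType := seq_sub (codom supp_space).
HB.instance Definition _ := Finite.on lattice.
HB.instance Definition _ := SubType.on lattice.

Definition lspace (X : lattice) : {vspace 'rV[R]_d} := ssval X.

Definition supp (x : face) : lattice := SeqSub (codom_f supp_space x).

Definition lattice_le (X Y : lattice) : bool := (lspace X <= lspace Y)%VS.

Lemma lattice_le_refl : reflexive lattice_le.
Proof. by move=> X; exact: subvv. Qed.

Lemma lattice_le_anti : antisymmetric lattice_le.
Proof. by move=> X Y /subv_anti XY; apply: val_inj. Qed.

Lemma lattice_le_trans : transitive lattice_le.
Proof. by move=> Y X Z; exact: subv_trans. Qed.

Fact lattice_display : Order.disp_t. Proof. exact: Order.Disp tt tt. Qed.
HB.instance Definition _ := Order.Le_isPOrder.Build lattice_display lattice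
  lattice_le_refl lattice_le_anti lattice_le_trans.

End Faces.

Section FaceAlgebra.
Context (k : fieldType) {R : realType} {d : nat} {A : arrangement R d}.

Definition kF : predArgType := {malg k[face A]}.
HB.instance Definition _ := GRing.Lmodule.on kF.

(* The product of the monoid algebra of the faces, locked like [pamul].       *)
Fact kF_key : unit. Proof. exact: tt. Qed.
Definition kF_mul : kF -> kF -> kF :=
  locked_with kF_key (fun u v : {malg k[face_monom A]} => u * v).

Definition kF_one : kF := 1 : {malg k[face_monom A]}.

Lemma kF_mulE (u v : {malg k[face_monom A]}) : kF_mul u v = u * v.
Proof. by rewrite /kF_mul unlock. Qed.

Lemma kF_mulA : associative kF_mul.
Proof. by move=> u v w; rewrite !kF_mulE mulrA. Qed.

Lemma kF_mul1l : left_id kF_one kF_mul.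
Proof. by move=> u; rewrite kF_mulE mul1r. Qed.

Lemma kF_mul1r : right_id kF_one kF_mul.
Proof. by move=> u; rewrite kF_mulE mulr1. Qed.

Lemma kF_mulDl : left_distributive kF_mul +%R.
Proof. by move=> u v w; rewrite !kF_mulE; exact: (@mulrDl {malg k[face_monom A]}). Qed.

Lemma kF_mulDr : right_distributive kF_mul +%R.
Proof. by move=> u v w; rewrite !kF_mulE; exact: (@mulrDr {malg k[face_monom A]}). Qed.

Lemma kF_one_neq0 : kF_one != 0.
Proof. exact: (oner_neq0 {malg k[face_monom A]}). Qed.

HB.instance Definition _ := GRing.Zmodule_isNzRing.Build kF
  kF_mulA kF_mul1l kF_mul1r kF_mulDl kF_mulDr kF_one_neq0.

Lemma kF_scaleAl (c : k) (u v : kF) : c *: (u * v) = (c *: u) * v.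
Proof.
change (c *: kF_mul u v = kF_mul (c *: u) v); rewrite !kF_mulE.
exact: (@scalerAl k {malg k[face_monom A]}).
Qed.

HB.instance Definition _ := GRing.Lmodule_isLalgebra.Build k kF kF_scaleAl.

Definition fbasis (x : face A) : kF := << x >>.

Lemma fbasisM (x y : face A) : fbasis x * fbasis y = fbasis (face_mul x y).
Proof.
change (kF_mul (fbasis x) (fbasis y) = fbasis (face_mul x y)).
by rewrite kF_mulE [LHS]fgmulUU mulr1.
Qed.

Lemma fbasis1 : fbasis (face_one A) = 1.
Proof. by []. Qed.

(* [n] is fuel for the recursion along the order of the lattice, see [idemE].  *)
Fixpoint idem_rec (r : lattice A -> face A) (n : nat) (X : lattice A) : kF :=
  if n is n'.+1 then
    fbasis (r X) - \sum_(Y : lattice A | (X < Y)%O) fbasis (r X) * idem_rec r n' Y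
  else 0.

Definition idem (r : lattice A -> face A) (X : lattice A) : kF :=
  idem_rec r #|{: lattice A}| X.

Lemma idem_recS r n X :
  idem_rec r n.+1 X =
  fbasis (r X) - \sum_(Y : lattice A | (X < Y)%O) fbasis (r X) * idem_rec r n Y.
Proof. by []. Qed.

Lemma idem_rec_fuel r n m X :
  (#|[set Y : lattice A | (X < Y)%O]| < n)%N ->
  (#|[set Y : lattice A | (X < Y)%O]| < m)%N ->
  idem_rec r n X = idem_rec r m X.
Proof.
elim: n m X => [|n IH] m X; first by rewrite ltn0.
case: m => [|m]; first by rewrite ltn0.
rewrite !ltnS => hn hm; rewrite !idem_recS.
have eqr Y : (X < Y)%O ->
    fbasis (r X) * idem_rec r n Y = fbasis (r X) * idem_rec r m Y :> kF.
  move=> XY.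
  have lt : (#|[set Z : lattice A | (Y < Z)%O]|
           < #|[set Z : lattice A | (X < Z)%O]|)%N.
    apply: proper_card; apply/properP; split.
      by apply/fintype.subsetP => Z; rewrite !inE; exact: lt_trans.
    by exists Y; rewrite inE ?ltxx.
  by rewrite (IH m Y (leq_trans lt hn) (leq_trans lt hm)).
by rewrite (eq_bigr _ eqr).
Qed.

Lemma idemE r X :
  idem r X = fbasis (r X) - \sum_(Y : lattice A | (X < Y)%O) fbasis (r X) * idem r Y.
Proof.
have lt (Y : lattice A) :
    (#|[set Z : lattice A | (Y < Z)%O]| < #|{: lattice A}|)%N.
  rewrite -cardsT; apply: proper_card; apply/properP; split.
    exact: finset.subsetT.
  by exists Y; rewrite inE ?ltxx.
by rewrite -idem_recS; apply: idem_rec_fuel; rewrite ?ltnS ?(ltnW (lt X)).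
Qed.

(* An orientation of [U] takes the value 1 on some ordered basis, and two
   ordered bases are given the same value iff the change of basis has positive
   determinant. The first clause forces the value 1 on the empty basis of the
   zero space.                                                                *)
Definition orientation (U : {vspace 'rV[R]_d}) (eps : seq 'rV[R]_d -> int) :
    Prop :=
  (exists2 b : (\dim U).-tuple 'rV[R]_d, basis_of U b & eps b = 1) /\
  (forall b b' : (\dim U).-tuple 'rV[R]_d, basis_of U b -> basis_of U b' ->
     eps b' = sgz (\det (\matrix_(i, j) coord b j b'`_i)) * eps b).

Implicit Type eps : lattice A -> seq 'rV[R]_d -> int.

Definition positive_basis eps (X : lattice A) : seq 'rV[R]_d :=
  xget [::] [set b : seq 'rV[R]_d | basis_of (lspace X) b /\ eps X b = 1]%classic.

Definition face_point (y : face A) : 'rV[R]_d :=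
  xget 0 [set v | in_face v y]%classic.

(* The incidence number [[x : y]], meaningful when [covers y x].              *)
Definition incidence eps (x y : face A) : int :=
  eps (supp y) (rcons (positive_basis eps (supp x)) (face_point y)).

Definition boundary eps (u : kF) : kF :=
  \sum_(y : face A) u@_y *:
    \sum_(x : face A | covers x y) (incidence eps y x)%:~R *: fbasis x.

Definition kQ : predArgType :=
  pathalg (fun X Y : lattice A => covers X Y) k.

HB.instance Definition _ := GRing.PzRing.on kQ.
HB.instance Definition _ := GRing.Lmodule.on kQ.
HB.instance Definition _ := GRing.PzSemiRing_isNonZero.Build kQ
  (paone_neq0 _ _ (supp (face_one A))).
HB.instance Definition _ := GRing.Lmodule_isLalgebra.Build k kQ
  (@pathalg_scaleAl _ _ k).

Definition qpathelt (X : lattice A) (s : seq (lattice A)) : kQ :=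
  pathelt (fun X Y : lattice A => covers X Y) k X s.

Definition two_path_sum (Z X : lattice A) : kQ :=
  \sum_(Y : lattice A | (Z < Y < X)%O) qpathelt X [:: Y; Z].

End FaceAlgebra.

Arguments kF k {R d} A.
Arguments kQ k {R d} A.

(* Main.v *)
Require Import Defs.
From HB Require Import structures.
From mathcomp Require Import all_boot all_order all_algebra.
From mathcomp Require Import boolp classical_sets reals.
From mathcomp Require Import finmap monalg perm fingroup.

(** Write [X -> Y] for the arrow of a cover relation, [e_X] for the
    idempotents and [z = r Z] for the chosen face of support [Z].

    A face kills [e_X] on the left unless its support lies below [X]
    ([idem_kill]), and [e_X] absorbs on the right every face whose support lies
    below [X] ([idem_absorb]).  Hence the image of an arrow [Y -> Z] collapses
    to [sum_y [z : y] y e_Y], over the faces [y > z] of support [Y]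
    ([arrow_image]).  There are two of them, on the two sides of [z], and their
    incidence numbers are opposite ([covers_two_faces]).

    The relations hold because the square of the boundary operator is zero.  In
    the image of the sum of the paths [X -> Y -> Z], the coefficient of
    [x e_X] is the sum of [[z : y] [y : x]] over the faces [y] strictly
    between [z] and [x].  Modulo the span of [z], the face [x] is a planar cone
    and the [y] are its two extremal rays; since [[z : y] [y : x]] is the
    orientation of a basis of [z] followed by vectors of [y] and [x], the two
    rays contribute opposite signs ([incidence_flag_sum]).

    That nothing else lies in the kernel is proved without resolutions or
    dimension counts.  Let [u] be a combination of paths from [X] to [Z], and
    let [H] be a hyperplane of the arrangement that contains [Z] but not [X].
    Modulo the relations, the last arrow [Y -> Z] of every path may be assumed
    to satisfy [Y] not contained in [H] ([reducible_hom]).  Indeed, if [Y] is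
    contained in [H], then by induction the path ends with [W -> Y -> Z] where
    [W] is not contained in [H]; in the interval [[Z, W]] the subspace [Y] is
    the intersection of [W] and [H], so the relation of this interval replaces
    [Y] by subspaces not contained in [H].  So [u] is equivalent to
    [sum_Y (Y -> Z) u_Y] with no [Y] inside [H].  If the image
    [sum_Y phi(Y -> Z) phi(u_Y)] vanishes, the part of it supported on the
    positive side of [H] vanishes too ([fbasis_half_sum]); this part has one
    term [+- y f_Y] per [Y], with [f_Y = phi(u_Y)] and [y] the face above [z]
    on that side.  Multiplying it by one such face kills all the other terms,
    and then [e_Y] recovers [f_Y], so every [phi(u_Y)] is zero
    ([half_sum_eq0]).  Induction on [Z] finishes the proof ([ker_hom]).

    Minimality: the elements with zero coefficients on the paths of length at
    most one and on all paths [X -> Y -> Z], for fixed [X] and [Z], form an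
    ideal, which contains every relation except that of [[Z, X]]
    ([two_path_sum_not_generated]). *)

Set Implicit Arguments.
Unset Strict Implicit.
Unset Printing Implicit Defensive.

Import Order.TTheory GRing.Theory Num.Theory.
Local Open Scope ring_scope.

(** * Faces, sign vectors and supports *)

Section FaceGeometry.
Context {R : realType} {d : nat} {A : arrangement R d}.
Implicit Types (x y z : face A) (X Y Z : lattice A) (i j : 'I_(hcount A)).
Implicit Types v w : 'rV[R]_d.

Lemma hformN i v : hform i (- v) = - hform i v.
Proof. by rewrite -scaleN1r hformZ mulN1r. Qed.

Definition sgn_at i v : option bool :=
  if hform i v == 0 then None else Some (0 < hform i v).

Lemma side_sgn_at i s v : side i s v = (s == sgn_at i v).
Proof.
rewrite /sgn_at; case: s => [[]|] /=; rewrite ?hyperplaneE;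
  by case: (ltrgt0P (hform i v)).
Qed.

Lemma in_faceE v x : in_face v x <-> forall i, x i = sgn_at i v.
Proof.
by split=> h i; [apply/eqP; rewrite -side_sgn_at | rewrite side_sgn_at h].
Qed.

Lemma face_of_subproof v :
  `[< exists w, forall i, side i ([ffun i => sgn_at i v] i) w >].
Proof. by apply/asboolP; exists v => i; rewrite ffunE side_sgn_at. Qed.

Definition face_of v : face A := Face (face_of_subproof v).

Lemma face_ofE v i : face_of v i = sgn_at i v.
Proof. exact: ffunE. Qed.

Lemma face_pointP x i : x i = sgn_at i (face_point x).
Proof.
move: i; apply/in_faceE; rewrite /face_point.
by case: xgetP => // h; have [v] := face_ex x; move/h.
Qed.

Lemma sgn_at_eq0 i v : (sgn_at i v == None) = (hform i v == 0).
Proof. by rewrite /sgn_at; case: (hform i v == 0). Qed.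

Lemma face_point_eq0 x i : (hform i (face_point x) == 0) = (x i == None).
Proof. by rewrite face_pointP sgn_at_eq0. Qed.

Lemma face_point_neq0 x i : (hform i (face_point x) != 0) = (x i != None).
Proof. by rewrite face_point_eq0. Qed.

Lemma sgn_at_scale i (a : R) v w :
  0 < a -> hform i w = a * hform i v -> sgn_at i w = sgn_at i v.
Proof. by move=> a0 e; rewrite /sgn_at e pmulr_rgt0 // mulf_eq0 gt_eqF. Qed.

Lemma sgn_at_eq i v w : hform i v != 0 -> hform i w != 0 ->
  (sgn_at i v == sgn_at i w) = (0 < hform i v * hform i w).
Proof.
move=> v0 w0; rewrite /sgn_at (negPf v0) (negPf w0).
case: (ltrgt0P (hform i v)) v0 => // hv _; case: (ltrgt0P (hform i w)) w0 =>
  // hw _.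
- by rewrite mulr_gt0 ?eqxx.
- by rewrite pmulr_rgt0 // [RHS]lt_gtF.
- by rewrite nmulr_rgt0 // [RHS]lt_gtF.
- by rewrite nmulr_rgt0 // hw eqxx.
Qed.

Lemma face_leP x y : reflect (forall i, x i != None -> y i = x i) (x <= y)%O.
Proof.
apply: (iffP forallP) => h i; have := h i.
  by case: (x i =P None) => //= _ /eqP.
by case: (x i =P None) => //= _ ->.
Qed.

Lemma le_face_mull x y : (x <= face_mul x y)%O.
Proof. by apply/face_leP => i; rewrite face_mulE; case: (x i). Qed.

Lemma face_mul_le x y : (x <= y)%O -> face_mul x y = y.
Proof.
by move/face_leP => h; apply: face_eqP => i; rewrite face_mulE; have := h i;
  case: (x i) => // s ->.
Qed.

Lemma face_mulxx x : face_mul x x = x.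
Proof. exact: face_mul_le. Qed.

(** An element of the lattice is determined by the hyperplanes that contain it,
    so this predicate turns the order of the lattice, and its comparison with
    supports, into statements about sign vectors. *)
Definition in_hyperplane X i : bool := (lspace X <= hyperplane i)%VS.

Lemma mem_supp_space x v :
  reflect (forall i, x i = None -> hform i v = 0) (v \in supp_space x).
Proof.
rewrite memvE; apply: (iffP subv_bigcapP) => h i.
  by move/eqP => /h; rewrite -memvE hyperplaneE => /eqP.
by move/eqP => /h /eqP; rewrite -memvE hyperplaneE.
Qed.

Lemma face_point_supp x : face_point x \in supp_space x.
Proof. by apply/mem_supp_space => i /eqP; rewrite -face_point_eq0 => /eqP. Qed.

Lemma in_hyperplane_supp x i : in_hyperplane (supp x) i = (x i == None).
Proof.
apply/idP/idP => [/subvP h|]; last first.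
  by move=> xi; apply: (bigcapv_inf i xi (subvv _)).
by rewrite -face_point_eq0 -hyperplaneE; apply/h/face_point_supp.
Qed.

Lemma supp_ex X : exists x, supp x = X.
Proof.
have /codomP[x xX] := ssvalP X; exists x.
by apply: val_inj => /=; rewrite xX.
Qed.

Lemma mem_lspace X v :
  reflect (forall i, in_hyperplane X i -> hform i v = 0) (v \in lspace X).
Proof.
apply: (iffP idP); have [x <-] := supp_ex X.
  move=> /mem_supp_space h i; rewrite in_hyperplane_supp => /eqP; exact: h.
move=> h; apply/mem_supp_space => i xi; apply: h.
by rewrite in_hyperplane_supp xi.
Qed.

Lemma lattice_leP X Y :
  reflect (forall i, in_hyperplane Y i -> in_hyperplane X i) (X <= Y)%O.
Proof.
apply: (iffP idP) => [XY i|h]; first exact: subv_trans.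
apply/subvP => v /mem_lspace hv; apply/mem_lspace => i /h; exact: hv.
Qed.

Lemma lattice_eqP X Y : in_hyperplane X =1 in_hyperplane Y -> X = Y.
Proof.
by move=> h; apply/le_anti/andP; split; apply/lattice_leP => i; rewrite h.
Qed.

Lemma supp_leP x X :
  reflect (forall i, in_hyperplane X i -> x i = None) (supp x <= X)%O.
Proof.
by apply: (iffP (lattice_leP _ _)) => h i /h; rewrite in_hyperplane_supp => /eqP.
Qed.

Lemma le_supp x y : (x <= y)%O -> (supp x <= supp y)%O.
Proof.
move/face_leP => h; apply/supp_leP => i; rewrite in_hyperplane_supp => /eqP yi.
by have := h i; rewrite yi; case: (x i) => // s /(_ isT).
Qed.

Lemma supp_mul_le x y X :
  (supp (face_mul x y) <= X)%O = (supp x <= X)%O && (supp y <= X)%O.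
Proof.
apply/supp_leP/andP => [h|[/supp_leP hx /supp_leP hy] i iX].
  by split; apply/supp_leP => i /h; rewrite face_mulE; case: (x i).
by rewrite face_mulE hx // hy.
Qed.

Lemma supp_mul x y : (supp x <= supp y)%O -> supp (face_mul x y) = supp y.
Proof.
move=> h; apply/le_anti; rewrite supp_mul_le h lexx /=.
by have := lexx (supp (face_mul x y)); rewrite supp_mul_le => /andP[].
Qed.

Lemma face_mul_supp x y : (supp y <= supp x)%O -> face_mul x y = x.
Proof.
move/supp_leP => h; apply: face_eqP => i; rewrite face_mulE.
have := h i; rewrite in_hyperplane_supp; case: (x i) => //.
by move=> ->.
Qed.

Lemma face_le_eq x y : (x <= y)%O -> supp x = supp y -> x = y.
Proof. by move=> /face_mul_le xy e; rewrite -[RHS]xy face_mul_supp // e. Qed.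

Lemma lt_supp x y : (x < y)%O -> (supp x < supp y)%O.
Proof.
rewrite !lt_neqAle => /andP[xy le]; rewrite le_supp // andbT.
by apply: contraNneq xy => /(face_le_eq le) ->.
Qed.

Lemma supp_mul_congr y y' x : supp y = supp y' ->
  supp (face_mul y x) = supp (face_mul y' x).
Proof.
move=> yy'; apply: lattice_eqP => i; have := congr1 (in_hyperplane^~ i) yy'.
by rewrite !in_hyperplane_supp !face_mulE; case: (y i); case: (y' i).
Qed.

Lemma mem_face_of v X : v \in lspace X = (supp (face_of v) <= X)%O.
Proof.
apply/mem_lspace/supp_leP => h i /h; rewrite face_ofE => /eqP.
  by rewrite -sgn_at_eq0 => /eqP.
by rewrite sgn_at_eq0 => /eqP.
Qed.

(** If [Y] covers [Z], cutting [Y] by a hyperplane that contains [Z] but not [Y]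
    leaves exactly [Z].  For [v] on the cut and [z] a face of support [Z], the
    support of [z * face_of v] lies between [Z] and [Y] and differs from [Y], so
    it is [Z]; thus [v] is in [Z].  Using a product of faces avoids having to
    show that the lattice is closed under intersections. *)
Lemma covers_section Y Z i v : covers Y Z -> v \in lspace Y ->
  in_hyperplane Z i -> ~~ in_hyperplane Y i -> hform i v = 0 -> v \in lspace Z.
Proof.
move=> /andP[ZY /existsPn cov] vY iZ iY vi.
have [z zZ] := supp_ex Z; pose f := face_mul z (face_of v).
have Zf : (Z <= supp f)%O by rewrite -zZ; apply/le_supp/le_face_mull.
have fY : (supp f <= Y)%O by rewrite supp_mul_le zZ (ltW ZY) -mem_face_of.
have nfY : supp f != Y.
  apply: contraNneq iY => <-; rewrite in_hyperplane_supp face_mulE.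
  move: iZ; rewrite -zZ in_hyperplane_supp => /eqP ->.
  by rewrite face_ofE sgn_at_eq0 vi.
have fZ : supp f = Z.
  have := cov (supp f); rewrite !lt_neqAle fY nfY Zf !andbT /= => /negP h.
  by apply/eqP; rewrite eq_sym; apply: contraT.
rewrite mem_face_of.
by have := lexx (supp f); rewrite {1}/f supp_mul_le fZ => /andP[].
Qed.

Lemma lt_hyperplane X Y : (X < Y)%O -> exists i, in_hyperplane X i && ~~
  in_hyperplane Y i.
Proof.
rewrite lt_neqAle => /andP[XY le]; apply/existsP; apply: contraNT XY.
rewrite negb_exists => /forallP h; apply/eqP/le_anti; rewrite le /=.
by apply/lattice_leP => i iX; have := h i; rewrite iX /= negbK.
Qed.

(** Both [Y] and [Y'] are the intersection of [W] with the hyperplane. *)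
Lemma covers_hyperplane W Y Y' i : covers W Y -> covers W Y' ->
  ~~ in_hyperplane W i -> in_hyperplane Y i -> in_hyperplane Y' i -> Y = Y'.
Proof.
move=> WY WY' iW iY iY'; apply/le_anti.
have aux U U' : covers W U -> covers W U' -> in_hyperplane U i ->
    in_hyperplane U' i -> (U' <= U)%O.
  move=> cU cU' iU iU'; apply/subvP => v vU'.
  have vW : v \in lspace W.
    by move: v vU'; apply/subvP; have /andP[/ltW] := cU'.
  by apply: (covers_section cU vW iU iW); have /mem_lspace := vU'; apply.
by rewrite !aux.
Qed.

End FaceGeometry.

(** * Orientations under a change of basis *)

(** A nontrivial permutation moves some index other than [i0], so the identity
    is the only permutation that contributes to the Leibniz formula. *)
Lemma det_row_replace (K : comPzRingType) n (M : 'M[K]_n) (i0 : 'I_n) :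
  (forall i j, i != i0 -> M i j = (i == j)%:R) -> \det M = M i0 i0.
Proof.
move=> h; rewrite /determinant (bigD1 (1%g : {perm _})) //= [X in _ + X]big1 ?addr0.
  rewrite odd_perm1 expr0 mul1r (bigD1 i0) //= perm1 big1 ?mulr1 // => i ii0.
  by rewrite perm1 h // eqxx.
move=> s s1; suff [i ii0 si] : exists2 i, i != i0 & s i != i.
  by rewrite (bigD1 i) //= h // eq_sym (negPf si) mul0r mulr0.
have [i si] : exists i, s i != i.
  apply/existsP; apply: contraR s1; rewrite negb_exists => /forallP f.
  by apply/eqP/permP => i; rewrite perm1; have := f i; rewrite negbK => /eqP.
have [ei|] := eqVneq i i0; last by exists i.
by exists (s i); rewrite -?ei // (inj_eq perm_inj).
Qed.

Section Orientation.
Context {R : realType} {d : nat}.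
Implicit Types (U : {vspace 'rV[R]_d}) (b c : seq 'rV[R]_d).
Implicit Types (eps : seq 'rV[R]_d -> int).

Lemma orientation_change U eps n (b b' : n.-tuple 'rV[R]_d) :
  orientation U eps -> basis_of U b -> basis_of U b' ->
  eps b' = sgz (\det (\matrix_(i, j) coord b j b'`_i)) * eps b.
Proof.
case=> _ h bU; have e := size_basis bU; case: n / e b b' bU => b b'; exact: h.
Qed.

Lemma orientation_pm U eps b : orientation U eps -> basis_of U b ->
  eps b = 1 \/ eps b = -1.
Proof.
move=> o bU; have [[c cU c1] h] := o.
have sb : size b == \dim U by rewrite (size_basis (X := in_tuple b) bU).
have := h c (Tuple sb) cU bU; have := h (Tuple sb) c bU cU.
rewrite /= c1 mulr1 => + eb; case: sgzP eb => _ -> //; rewrite ?mulr0 //; auto.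
Qed.

(** Replacing one basis vector only changes one row of the identity matrix. *)
Lemma orientation_replace U eps b1 b2 v v' s (a : R) :
  orientation U eps ->
  basis_of U (b1 ++ v :: b2) -> basis_of U (b1 ++ v' :: b2) ->
  v' = a *: v + s -> s \in <<b1 ++ b2>>%VS ->
  eps (b1 ++ v' :: b2) = sgz a * eps (b1 ++ v :: b2).
Proof.
move=> o bU bU' ev' sb; pose n := size (b1 ++ b2).
have sz w : size (b1 ++ w :: b2) == n.+1.
  by rewrite /n !size_cat /= addnS.
have lt_i0 : (size b1 < n.+1)%N by rewrite ltnS /n size_cat leq_addr.
pose i0 := Ordinal lt_i0.
have := orientation_change (b := Tuple (sz v)) (b' := Tuple (sz v')) o bU bU'.
have fr : free (Tuple (sz v)) := basis_free bU.
have nth_lift w j : (b1 ++ w :: b2)`_(bump (size b1) j) = (b1 ++ b2)`_j.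
  rewrite /bump !nth_cat; case: (leqP (size b1) j) => h; last by rewrite add0n h.
  by rewrite add1n ltnNge ?leqW 1?leqW //= subSn.
have cl i (j : 'I_n) :
    coord (Tuple (sz v)) i (b1 ++ b2)`_j = (lift i0 j == i)%:R.
  by rewrite -(nth_lift v); exact: (coord_free (lift i0 j) i fr).
rewrite /= => ->; congr (sgz _ * _).
rewrite (det_row_replace (i0 := i0)) => [|i j ii0]; rewrite mxE /=.
  have -> : (b1 ++ v' :: b2)`_(size b1) = v' by rewrite nth_cat ltnn subnn.
  have cv : coord (Tuple (sz v)) i0 (Tuple (sz v))`_i0 = 1.
    by rewrite coord_free // eqxx.
  rewrite /= nth_cat ltnn subnn /= in cv.
  rewrite ev' linearD linearZ /= cv mulr1 (coord_span (X :=
    in_tuple (b1 ++ b2)) sb).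
  rewrite linear_sum big1 ?addr0 //= => j _.
  by rewrite linearZ /= cl eq_sym (negPf (neq_lift _ _)) mulr0.
rewrite eq_sym in ii0; have [l -> _] := unlift_some ii0.
by rewrite nth_lift cl.
Qed.

(** In the basis [rcons c u], the matrix of [rcons b u] is block diagonal, with
    the matrix of [b] in [c] and [1] as blocks.  This is what makes a product of
    two incidence numbers a single orientation. *)
Lemma orientation_rcons U V eps epsV b c u :
  orientation U eps -> orientation V epsV ->
  basis_of V b -> basis_of V c -> epsV c = 1 ->
  basis_of U (rcons b u) -> basis_of U (rcons c u) ->
  eps (rcons b u) = epsV b * eps (rcons c u).
Proof.
move=> o oV bV cV c1 bU cU; pose n := size b.
have sb : size b == n by [].
have sc : size c == n.
  by rewrite -(size_basis (X := in_tuple c) cV) (size_basis (X := in_tuple b) bV).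
have sbu : size (rcons b u) == n.+1 by rewrite size_rcons.
have scu : size (rcons c u) == n.+1 by rewrite size_rcons eqSS.
have := orientation_change (b := Tuple sc) (b' := Tuple sb) oV cV bV.
have := orientation_change (b := Tuple scu) (b' := Tuple sbu) o cU bU.
rewrite /= => -> ->; rewrite c1 mulr1; congr (sgz _ * _).
have fr : free (Tuple scu) := basis_free cU.
have fr' : free (Tuple sc) := basis_free cV.
have bump_max (j : 'I_n) : bump n j = j by rewrite /bump leqNgt ltn_ord.
have cu j : coord (Tuple scu) j u = (ord_max == j)%:R.
  have := coord_free ord_max j fr.
  by rewrite /= nth_rcons (eqP sc) ltnn eqxx.
have ec (j : 'I_n) : c`_j = (Tuple scu)`_(lift ord_max j).
  by rewrite /= bump_max nth_rcons (eqP sc) ltn_ord.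
rewrite (expand_det_row _ ord_max) big_ord_recr /= big1 => [|j _].
  rewrite add0r mxE /= nth_rcons ltnn eqxx cu eqxx mul1r.
  rewrite /cofactor /= addnn -signr_odd odd_double expr0 mul1r; congr (\det _).
  apply/matrixP => i j; rewrite !mxE /= !bump_max nth_rcons ltn_ord.
  have bi : b`_i \in <<Tuple sc>>%VS.
    rewrite (span_basis cV); apply: (basis_mem bV); apply: mem_nth.
    exact: ltn_ord.
  rewrite [in LHS](coord_span bi) linear_sum (bigD1 j) //= linearZ /= ec.
  rewrite coord_free // eqxx mulr1 big1 ?addr0 // => l lj.
  rewrite linearZ /= ec coord_free // (inj_eq lift_inj) (negPf lj).
  by rewrite mulr0.
rewrite mxE /= nth_rcons ltnn eqxx cu -val_eqE /=.
by rewrite gtn_eqF ?mul0r //.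
Qed.

End Orientation.

(** * Cover relations of the lattice and incidence numbers *)

Section Covers.
Context {R : realType} {d : nat} {A : arrangement R d}.
Implicit Types (x y z : face A) (X Y Z W : lattice A) (i j : 'I_(hcount A)).
Implicit Types (v w : 'rV[R]_d) (b : seq 'rV[R]_d).

Lemma covers_lt Y Z : covers Y Z -> (Z < Y)%O.
Proof. by case/andP. Qed.

Lemma mem_lspace_le Z Y v : (Z <= Y)%O -> v \in lspace Z -> v \in lspace Y.
Proof. by move=> ZY; apply/subvP. Qed.

(** A cover relation has codimension one: [Y] is spanned by [Z] and any vector of
    [Y] outside [Z]. *)
Lemma covers_line Y Z v w : covers Y Z -> v \in lspace Y -> v \notin lspace Z ->
  w \in lspace Y -> exists a : R, w - a *: v \in lspace Z.
Proof.
move=> YZ vY vZ wY; have [i /andP[iZ iY]] := lt_hyperplane (covers_lt YZ).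
have vi : hform i v != 0 by apply: contraNneq vZ; exact: covers_section YZ vY iZ iY.
exists (hform i w / hform i v); apply: (covers_section YZ _ iZ iY).
  by rewrite memvB ?memvZ.
by rewrite hformD hformN hformZ divfK ?subrr.
Qed.

Lemma covers_basis Y Z b v : covers Y Z -> basis_of (lspace Z) b ->
  v \in lspace Y -> v \notin lspace Z -> basis_of (lspace Y) (rcons b v).
Proof.
move=> YZ /andP[/eqP sb fb] vY vZ; rewrite (perm_basis _ (permEl (perm_rcons _ _))).
apply/andP; split; last by rewrite free_cons sb vZ.
rewrite span_cons sb eqEsubv; apply/andP; split.
  by rewrite subv_add -memvE vY; have := ltW (covers_lt YZ).
apply/subvP => w wY; have [a aZ] := covers_line YZ vY vZ wY.
by rewrite -(subrK (a *: v) w) addrC memv_add ?memvZ ?memv_line.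
Qed.

Lemma face_point_lspace x X : (supp x <= X)%O -> face_point x \in lspace X.
Proof.
move=> xX; apply/mem_lspace => i iX; apply/eqP; rewrite face_point_eq0.
by apply/eqP; move: i iX; apply/supp_leP.
Qed.

Lemma face_point_notin x X : ~~ (supp x <= X)%O -> face_point x \notin lspace X.
Proof.
apply: contra => /mem_lspace h; apply/supp_leP => i /h /eqP.
by rewrite face_point_eq0 => /eqP.
Qed.

Lemma covers_dim Y Z : covers Y Z -> \dim (lspace Y) = (\dim (lspace Z)).+1.
Proof.
move=> YZ; have [y yY] := supp_ex Y.
have yZ : face_point y \notin lspace Z.
  by apply: face_point_notin; rewrite yY lt_geF ?covers_lt.
have yy : face_point y \in lspace Y by rewrite face_point_lspace ?yY.
have := covers_basis YZ (vbasisP _) yy yZ.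
by move/(size_basis (X := in_tuple _)); rewrite size_rcons size_tuple.
Qed.

Lemma lattice_dim_lt Z X : (Z < X)%O -> (\dim (lspace Z) < \dim (lspace X))%N.
Proof.
rewrite lt_neqAle => /andP[ZX le]; rewrite ltn_neqAle (dimvS le) andbT.
by apply: contraNneq ZX => e; apply/eqP/val_inj/eqP;
  rewrite eqEdim -/(lspace _) e leqnn andbT.
Qed.

(** A face above [x] whose support covers that of [x] is determined by the side
    of a separating hyperplane on which it lies: modulo the span of [x], the
    points of [y] and [y'] are proportional, with a positive ratio. *)
Lemma covers_face_eq x y y' i : covers (supp y) (supp x) -> supp y' = supp y ->
  (x < y)%O -> (x < y')%O ->
  in_hyperplane (supp x) i -> ~~ in_hyperplane (supp y) i ->
  y i = y' i -> y = y'.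
Proof.
move=> yx ey xy xy' ix iy yi.
have yy : face_point y \in lspace (supp y) by exact: face_point_lspace.
have y'y : face_point y' \in lspace (supp y) by rewrite face_point_lspace ?ey.
have ynx : face_point y \notin lspace (supp x).
  by apply: face_point_notin; rewrite lt_geF ?covers_lt.
have [a ax] := covers_line yx yy ynx y'y.
have ha j : x j = None -> hform j (face_point y') = a * hform j (face_point y).
  move=> xj; have := mem_lspace _ _ ax j.
  rewrite in_hyperplane_supp xj eqxx => /(_ isT).
  by rewrite hformD hformN hformZ => /eqP; rewrite subr_eq0 => /eqP.
have {}ix : x i = None by apply/eqP; rewrite -in_hyperplane_supp.
have yi0 : hform i (face_point y) != 0.
  by rewrite face_point_neq0 -in_hyperplane_supp.
have a0 : 0 < a.
  have y'i0 : hform i (face_point y') != 0.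
    by rewrite face_point_neq0 -yi -in_hyperplane_supp.
  move/eqP: yi; rewrite !face_pointP (sgn_at_eq yi0 y'i0) (ha i ix) mulrCA.
  have yi2 : 0 < hform i (face_point y) * hform i (face_point y).
    by rewrite -expr2 exprn_even_gt0.
  by rewrite pmulr_lgt0.
apply: face_eqP => j; have [xj|xj] := eqVneq (x j) None.
  by rewrite !face_pointP; apply/esym/(sgn_at_scale a0)/ha.
by rewrite (face_leP _ _ (ltW xy) j xj) (face_leP _ _ (ltW xy') j xj).
Qed.

Lemma face_lift z Y : (supp z < Y)%O -> exists2 y, (z < y)%O & supp y = Y.
Proof.
move=> zY; have [y yY] := supp_ex Y.
have sY : supp (face_mul z y) = Y by rewrite supp_mul yY // ltW.
exists (face_mul z y) => //; rewrite lt_neqAle le_face_mull andbT.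
by apply: contraTneq zY => ->; rewrite sY ltxx.
Qed.

Definition face_opp y : face A := face_of (- face_point y).

Lemma face_oppE y i : face_opp y i = omap negb (y i).
Proof.
rewrite face_ofE face_pointP /sgn_at hformN oppr_eq0 oppr_gt0.
by case: ltrgt0P.
Qed.

Lemma supp_opp y : supp (face_opp y) = supp y.
Proof.
apply: lattice_eqP => i; rewrite !in_hyperplane_supp face_oppE.
by case: (y i).
Qed.

End Covers.

Section Incidence.
Context {R : realType} {d : nat} {A : arrangement R d}.
Context {eps : lattice A -> seq 'rV[R]_d -> int}.
Hypothesis eps_orientation : forall X, orientation (lspace X) (eps X).
Implicit Types (x y z : face A) (X Y Z W : lattice A) (i j : 'I_(hcount A)).
Implicit Types (v w : 'rV[R]_d) (b : seq 'rV[R]_d).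

Lemma positive_basisP X :
  basis_of (lspace X) (positive_basis eps X) /\ eps X (positive_basis eps X) = 1.
Proof.
rewrite /positive_basis; case: xgetP => // h.
by have [[b bX b1] _] := eps_orientation X; case: (h (tval b)).
Qed.

Lemma incidence_basis x y : covers (supp y) (supp x) ->
  basis_of (lspace (supp y)) (rcons (positive_basis eps (supp x)) (face_point y)).
Proof.
move=> yx; apply: (covers_basis yx (positive_basisP _).1).
  exact: face_point_lspace.
by apply: face_point_notin; rewrite lt_geF ?covers_lt.
Qed.

Lemma incidence_pm x y : covers (supp y) (supp x) ->
  incidence eps x y = 1 \/ incidence eps x y = -1.
Proof. by move=> /incidence_basis; apply: orientation_pm. Qed.

(** The incidence number only depends on the supports and on the side of a
    separating hyperplane.  It serves both to compare the two faces above one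
    face, and to transport incidence numbers along left multiplication. *)
Lemma incidence_compare x y x' y' i :
  covers (supp y) (supp x) -> supp x' = supp x -> supp y' = supp y ->
  in_hyperplane (supp x) i -> ~~ in_hyperplane (supp y) i ->
  incidence eps x' y' = (if y i == y' i then 1 else -1) * incidence eps x y.
Proof.
move=> yx ex ey ix iy; rewrite /incidence ex ey.
have yy : face_point y \in lspace (supp y) by exact: face_point_lspace.
have y'y : face_point y' \in lspace (supp y) by rewrite face_point_lspace ?ey.
have ynx : face_point y \notin lspace (supp x).
  by apply: face_point_notin; rewrite lt_geF ?covers_lt.
have [a ax] := covers_line yx yy ynx y'y.
have bx := incidence_basis yx.
have bx' := incidence_basis (x := x) (y := y'); rewrite ey in bx'.
move: bx (bx' yx); rewrite -!cats1 => bx {}bx'.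
rewrite (orientation_replace (eps_orientation _) bx bx' (s :=
  face_point y' - a *: face_point y) (a := a)).
- congr (_ * _); have := mem_lspace _ _ ax i ix.
  rewrite hformD hformN hformZ => /eqP; rewrite subr_eq0 => /eqP e.
  have yi : hform i (face_point y) != 0.
    by rewrite face_point_neq0 -in_hyperplane_supp.
  have y'i : hform i (face_point y') != 0.
    by rewrite face_point_neq0 -in_hyperplane_supp ey.
  rewrite !face_pointP (sgn_at_eq yi y'i) e mulrCA.
  have yi2 : 0 < hform i (face_point y) * hform i (face_point y).
    by rewrite -expr2 exprn_even_gt0.
  rewrite pmulr_lgt0 //; case: sgzP => // a0.
  by move: y'i; rewrite e a0 mul0r eqxx.
- by rewrite addrC subrK.
- by rewrite cats0 (span_basis (positive_basisP _).1).
Qed.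

Lemma covers_two_faces z Y i : covers Y (supp z) ->
  in_hyperplane (supp z) i -> ~~ in_hyperplane Y i ->
  exists y1 y2, [/\ [/\ (z < y1)%O, supp y1 = Y & y1 i = Some true],
    [/\ (z < y2)%O, supp y2 = Y & y2 i = Some false],
    incidence eps z y2 = - incidence eps z y1
    & forall y, (z < y)%O -> supp y = Y -> y = y1 \/ y = y2].
Proof.
move=> Yz iz iY.
have zi : z i = None by apply/eqP; rewrite -in_hyperplane_supp.
have ex (s : bool) : exists y, [/\ (z < y)%O, supp y = Y & y i = Some s].
  have [y zy yY] := face_lift (covers_lt Yz).
  have : y i != None by rewrite -in_hyperplane_supp yY.
  case yi: (y i) => [t|//] _.
  have [ts|ts] := eqVneq t s; first by exists y; rewrite yi ts.
  have sY : supp (face_mul z (face_opp y)) = Y.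
    by rewrite supp_mul supp_opp // yY ltW ?covers_lt.
  exists (face_mul z (face_opp y)); split => //.
    rewrite lt_neqAle le_face_mull andbT; apply/eqP => e.
    by have := covers_lt Yz; rewrite e sY ltxx.
  by rewrite face_mulE zi face_oppE yi; case: t s ts {yi} => -[].
have [y1 [zy1 y1Y y1i]] := ex true; have [y2 [zy2 y2Y y2i]] := ex false.
exists y1, y2; split => //.
  rewrite (@incidence_compare z y1 z y2 i) ?y1Y ?y2Y //.
  by rewrite y1i y2i mulN1r.
move=> y zy yY; have : y i != None by rewrite -in_hyperplane_supp yY.
case yi: (y i) => [[]|//] _; [left|right].
- by apply: (@covers_face_eq _ _ _ z y y1 i); rewrite ?yY // yi.
- by apply: (@covers_face_eq _ _ _ z y y2 i); rewrite ?yY // yi.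
Qed.

End Incidence.

(** * Flags of length two: the square of the boundary is zero *)

Section Codim2.
Context {R : realType} {d : nat} {A : arrangement R d}.
Implicit Types (x y z : face A) (X Y Z W : lattice A) (i j : 'I_(hcount A)).
Implicit Types (v w : 'rV[R]_d) (b : seq 'rV[R]_d).

Lemma face_le_none x y i : (x <= y)%O -> y i = None -> x i = None.
Proof.
move=> /face_leP/(_ i) h yi; apply/eqP; apply: contraT => xi.
by have := h xi; rewrite yi => e; rewrite -e in xi.
Qed.

Lemma lt_face_sign x y : (x < y)%O -> exists2 i, x i = None & y i != None.
Proof.
move/lt_supp/lt_hyperplane => [i]; rewrite !in_hyperplane_supp => /andP[/eqP xi yi].
by exists i.
Qed.

(** Starting from [w], go along the direction of [x]: far away one is inside
    the cone of [x] modulo [z], and the last point before this cone is left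
    backwards is on a proper face of it.  The hyperplanes [i] and [i'] ensure
    that [w] is not in the span of [x] and [z], so that this point is not in the
    span of [z]. *)
Lemma face_between x z w i i' : (z < x)%O -> w \in lspace (supp x) ->
  z i = None -> x i != None -> hform i w = 0 ->
  z i' = None -> hform i' w != 0 ->
  exists (s : R) y, (z < y < x)%O /\
    forall j, z j = None -> y j = sgn_at j (w + s *: face_point x).
Proof.
move=> zx wx zi xi wi zi' wi'.
(* [F j] is the parameter where the line [w + s x] crosses hyperplane [j]. *)
pose P j := (z j == None) && (x j != None).
pose F j := - hform j w / hform j (face_point x).
have Pi : P i by rewrite /P zi.
have [j0 /andP[/eqP zj0 xj0] F_max] := arg_maxP F Pi.
pose s := F j0; pose p := w + s *: face_point x; exists s.
have hp j : hform j p = hform j w + s * hform j (face_point x).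
  by rewrite hformD hformZ.
have px : p \in lspace (supp x).
  by rewrite memvD ?memvZ ?face_point_lspace.
have yE j : z j = None -> face_mul z (face_of p) j = sgn_at j p.
  by move=> zj; rewrite face_mulE zj face_ofE.
exists (face_mul z (face_of p)); split=> //; apply/andP; split.
  rewrite lt_neqAle le_face_mull andbT; apply/eqP => e.
  have p0 j : z j = None -> hform j p = 0.
    by move=> zj; apply/eqP; rewrite -sgn_at_eq0 -yE // -e zj.
  have /eqP := p0 i zi; rewrite hp wi add0r mulf_eq0 face_point_eq0 (negPf xi) orbF.
  move=> /eqP s0; have := p0 i' zi'; rewrite hp s0 mul0r addr0.
  by move/eqP; rewrite (negPf wi').
rewrite lt_neqAle; apply/andP; split.
  apply: contraNneq (xj0) => <-; rewrite yE // sgn_at_eq0 hp /s /F divfK ?addrN //.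
  by rewrite face_point_neq0.
apply/face_leP => j; have [zj|zj] := eqVneq (z j) None; last first.
  move=> _; rewrite face_mulE (face_leP _ _ (ltW zx) j zj).
  by case: (z j) zj.
rewrite yE // sgn_at_eq0 => pj.
have xj : x j != None.
  apply: contraNneq pj => xj; apply/eqP; move/mem_lspace: px; apply.
  by rewrite in_hyperplane_supp xj.
have xj' : hform j (face_point x) != 0 by rewrite face_point_neq0.
rewrite face_pointP; apply/eqP; rewrite sgn_at_eq // lt_neqAle eq_sym mulf_neq0 //=.
have -> : hform j p = (s - F j) * hform j (face_point x).
  by rewrite hp mulrBl /F divfK // opprK addrC.
by rewrite mulrCA -expr2 mulr_ge0 ?sqr_ge0 // subr_ge0; apply: F_max; rewrite /P zj.
Qed.

(** Modulo the span of [z], the cone [x] is planar and [y0], [y1] are its two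
    sides, so [x] is a positive combination of [y0] and [y1]; solving for [y1]
    gives the negative coefficient of [y0]. *)
Lemma face_between_line x z y0 y1 :
  covers (supp x) (supp y0) -> covers (supp y0) (supp z) ->
  (z < y0 < x)%O -> (z < y1 < x)%O -> y0 != y1 ->
  exists a b : R, a < 0 /\
    face_point y1 - a *: face_point y0 - b *: face_point x \in lspace (supp z).
Proof.
move=> xy0 y0z /andP[zy0 ltxy0] /andP[zy1 ltxy1] y01.
(* The equation of [y0] inside [x] determines [b]. *)
have [i0 y0i xi] := lt_face_sign ltxy0.
have zi0 : z i0 = None by exact: face_le_none (ltW zy0) y0i.
have xi' : hform i0 (face_point x) != 0 by rewrite face_point_neq0.
have y0i' : hform i0 (face_point y0) = 0.
  by apply/eqP; rewrite face_point_eq0 y0i.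
have y1x : face_point y1 \in lspace (supp x).
  by rewrite face_point_lspace // le_supp // ltW.
pose b := hform i0 (face_point y1) / hform i0 (face_point x).
have uy0 : face_point y1 - b *: face_point x \in lspace (supp y0).
  apply: (covers_section (i := i0) xy0).
  - by apply: memvB => //; apply: memvZ; exact: face_point_lspace.
  - by rewrite in_hyperplane_supp y0i.
  - by rewrite in_hyperplane_supp.
  - by rewrite hformD hformN hformZ divfK ?subrr.
have y0y0 : face_point y0 \in lspace (supp y0) by exact: face_point_lspace.
have y0nz : face_point y0 \notin lspace (supp z).
  by apply: face_point_notin; rewrite lt_geF ?covers_lt.
have [a az] := covers_line y0z y0y0 y0nz uy0; exists a, b; split;
  last by rewrite addrAC.
have hE j : z j = None -> hform j (face_point y1) =
    a * hform j (face_point y0) + b * hform j (face_point x).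
  move=> zj; have /mem_lspace/(_ j) := az; rewrite in_hyperplane_supp zj eqxx.
  move=> /(_ isT); rewrite !(hformD, hformN, hformZ) => /eqP.
  by rewrite subr_eq0 subr_eq => /eqP.
have agree y j : (y < x)%O -> y j != None ->
    0 < hform j (face_point y) * hform j (face_point x).
  move=> yx yj; have e := face_leP _ _ (ltW yx) j yj.
  rewrite -sgn_at_eq ?face_point_neq0 // -?face_pointP ?e //.
(* Otherwise [b = 0], so [y1] would be on the ray of [y0]. *)
have y1i : y1 i0 != None.
  apply: contraNneq y01 => y1i.
  have b0 : b = 0 by rewrite /b (_ : hform i0 _ = 0) ?mul0r //; apply/eqP;
    rewrite face_point_eq0 y1i.
  have {}hE j : z j = None -> hform j (face_point y1) = a * hform j (face_point y0).
    by move/hE; rewrite b0 mul0r addr0.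
  have [j zj y1j] := lt_face_sign zy1.
  have a0 : 0 < a.
    have := agree _ _ ltxy1 y1j; rewrite hE //.
    have y1j' : hform j (face_point y1) != 0 by rewrite face_point_neq0.
    have y0j : y0 j != None.
      by apply: contraNneq y1j' => y0j; rewrite hE // mulf_eq0 face_point_eq0 y0j
        orbT.
    by rewrite -mulrA pmulr_lgt0 ?agree.
  apply/eqP/face_eqP => l; have [zl|zl] := eqVneq (z l) None.
    by rewrite !face_pointP; apply/esym/(sgn_at_scale a0)/hE.
  by rewrite (face_leP _ _ (ltW zy0) _ zl) (face_leP _ _ (ltW zy1) _ zl).
have b0 : 0 < b.
  by have := agree _ _ ltxy1 y1i; rewrite hE // y0i' mulr0 add0r -mulrA
    pmulr_lgt0 // -expr2 exprn_even_gt0.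
(* The equation of [y1] inside [x] vanishes at [y1] and has the sign of [x] at
   [y0], so [a] and [b] have opposite signs. *)
have [j1 y1j xj] := lt_face_sign ltxy1.
have zj1 : z j1 = None by exact: face_le_none (ltW zy1) y1j.
have := hE j1 zj1; have /eqP -> : hform j1 (face_point y1) == 0 by rewrite
  face_point_eq0 y1j.
move/esym/eqP; rewrite addr_eq0 => /eqP e.
have xj' : hform j1 (face_point x) != 0 by rewrite face_point_neq0.
have y0j : y0 j1 != None.
  apply: contraTneq b0 => y0j; have e0 : hform j1 (face_point y0) =
    0 by apply/eqP; rewrite face_point_eq0 y0j.
  move/eqP: e; rewrite e0 mulr0 eq_sym oppr_eq0 mulf_eq0 (negPf xj') orbF.
  by move/eqP ->; rewrite ltxx.
rewrite -(pmulr_llt0 _ (agree _ _ ltxy0 y0j)) mulrA e mulNr oppr_lt0 -mulrA.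
by rewrite pmulr_rgt0 // -expr2 exprn_even_gt0.
Qed.

(** The second face is found in the direction opposite to [y0]. *)
Lemma face_between_two x z y0 : (z < y0 < x)%O ->
  exists2 y1, (z < y1 < x)%O & y0 != y1.
Proof.
move=> /andP[zy0 y0x]; have zx := lt_trans zy0 y0x.
have [i y0i xi] := lt_face_sign y0x; have [i' zi' y0i'] := lt_face_sign zy0.
have zi : z i = None by exact: face_le_none (ltW zy0) y0i.
have hi : hform i (face_point y0) = 0 by apply/eqP; rewrite face_point_eq0 y0i.
have hi' : hform i' (face_point y0) != 0 by rewrite face_point_neq0.
have [|||s [y1 [zy1x hy1]]] := @face_between x z (- face_point y0) i i' zx _ zi
  xi _ zi'.
- by rewrite memvN face_point_lspace // le_supp // ltW.
- by rewrite hformN hi oppr0.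
- by rewrite hformN oppr_eq0.
exists y1 => //; apply/eqP => e; rewrite -e in hy1.
have s0 : s = 0.
  have /esym/eqP := hy1 i zi; rewrite y0i sgn_at_eq0 hformD hformN hi oppr0 add0r
    hformZ.
  by rewrite mulf_eq0 face_point_eq0 (negPf xi) orbF => /eqP.
have := hy1 i' zi'; rewrite s0 scale0r addr0 face_pointP => /eqP.
rewrite sgn_at_eq ?hformN ?oppr_eq0 // mulrN oppr_gt0 -expr2.
by rewrite le_gtF // sqr_ge0.
Qed.

Lemma face_between_ex x z Y : (z < x)%O -> (supp z < Y < supp x)%O ->
  exists y, (z < y < x)%O.
Proof.
move=> zx /andP[zY Yx]; have [y yY] := supp_ex Y.
have [i /andP[iY ix]] := lt_hyperplane Yx; have [i' /andP[iz' iY']] :=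
  lt_hyperplane zY.
have iz : in_hyperplane (supp z) i by move/ltW/lattice_leP: zY; apply.
have wY : face_point y \in lspace Y by rewrite face_point_lspace ?yY.
have [||||||s [y1 [h _]]] := @face_between x z (face_point y) i i' zx.
- by apply: mem_lspace_le wY; exact: ltW.
- by apply/eqP; rewrite -in_hyperplane_supp.
- by rewrite -in_hyperplane_supp.
- by have /mem_lspace := wY; apply.
- by apply/eqP; rewrite -in_hyperplane_supp.
- by rewrite face_point_neq0 -in_hyperplane_supp yY.
by exists y1.
Qed.

Context {eps : lattice A -> seq 'rV[R]_d -> int}.
Hypothesis eps_orientation : forall X, orientation (lspace X) (eps X).

Lemma incidence_flag x y z :
  covers (supp x) (supp y) -> covers (supp y) (supp z) ->
  incidence eps z y * incidence eps y x =
  eps (supp x) (rcons (rcons (positive_basis eps (supp z)) (face_point y))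
    (face_point x)).
Proof.
move=> xy yz; have byz := incidence_basis eps_orientation yz.
have [bY bY1] := positive_basisP eps_orientation (supp y).
rewrite (orientation_rcons (eps_orientation (supp x)) (eps_orientation (supp y))
  byz bY bY1) //.
  apply: (covers_basis xy byz); first exact: face_point_lspace.
  by apply: face_point_notin; rewrite lt_geF ?covers_lt.
exact: incidence_basis.
Qed.

Lemma incidence_flag_opp x y0 y1 z :
  covers (supp x) (supp y0) -> covers (supp y0) (supp z) ->
  covers (supp x) (supp y1) -> covers (supp y1) (supp z) ->
  (z < y0 < x)%O -> (z < y1 < x)%O -> y0 != y1 ->
  incidence eps z y1 * incidence eps y1 x = - (incidence eps z y0 * incidence eps
    y0 x).
Proof.
move=> xy0 y0z xy1 y1z zy0x zy1x y01; rewrite !incidence_flag //.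
have [a [b [a0 h]]] := face_between_line xy0 y0z zy0x zy1x y01.
pose s := face_point y1 - a *: face_point y0.
have flag y : covers (supp x) (supp y) -> covers (supp y) (supp z) ->
    basis_of (lspace (supp x)) (positive_basis eps (supp z) ++ [:: face_point y;
      face_point x]).
  move=> xy yz; rewrite -cat_rcons cats1.
  apply: (covers_basis xy (incidence_basis eps_orientation yz));
    first exact: face_point_lspace.
  by apply: face_point_notin; rewrite lt_geF ?covers_lt.
have f0 := flag _ xy0 y0z; have f1 := flag _ xy1 y1z.
rewrite -!cats1 -!catA /=.
rewrite (orientation_replace (eps_orientation _) f0 f1 (s := s) (a := a)).
- by rewrite (ltr0_sgz a0) mulN1r.
- by rewrite /s addrC subrK.
- rewrite span_cat (span_basis (positive_basisP eps_orientation _).1) span_seq1.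
  by rewrite -(subrK (b *: face_point x) s) memv_add ?memvZ ?memv_line.
Qed.

(** Two distinct faces between [z] and [x] contribute opposite signs, so there
    cannot be three of them, and [face_between_two] gives at least two. *)
Lemma incidence_flag_sum x z :
  (z < x)%O -> (exists Y, (supp z < Y < supp x)%O) ->
  (forall Y, (supp z < Y < supp x)%O -> covers (supp x) Y /\ covers Y (supp z)) ->
  \sum_(y : face A | (z < y < x)%O) incidence eps z y * incidence eps y x = 0.
Proof.
move=> zx [Y zYx] cov.
have {}cov y : (z < y < x)%O ->
    covers (supp x) (supp y) /\ covers (supp y) (supp z).
  by move=> /andP[zy yx]; apply: cov; rewrite !lt_supp.
have [y0 zy0x] := face_between_ex zx zYx.
have [y1 zy1x y01] := face_between_two zy0x.
have [xy0 y0z] := cov _ zy0x; have [xy1 y1z] := cov _ zy1x.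
have opp01 := incidence_flag_opp xy0 y0z xy1 y1z zy0x zy1x y01.
rewrite (bigD1 y0) //= (bigD1 y1) /=; last by rewrite zy1x eq_sym.
rewrite opp01 big1 ?addr0 ?subrr // => y /andP[/andP[zyx yy0] yy1].
have [xy yz] := cov _ zyx.
have := incidence_flag_opp xy1 y1z xy yz zy1x zyx; rewrite eq_sym => /(_ yy1).
rewrite opp01 opprK (incidence_flag_opp xy0 y0z xy yz zy0x zyx) 1?eq_sym //.
case: (incidence_pm eps_orientation y0z) => ->;
by case: (incidence_pm eps_orientation xy0) => ->.
Qed.

End Codim2.

(** * The idempotents and the image of an arrow *)

Section LatticeInduction.
Context {R : realType} {d : nat} {A : arrangement R d}.

Lemma lattice_ind_up (P : lattice A -> Prop) :
  (forall X, (forall Y, (X < Y)%O -> P Y) -> P X) -> forall X, P X.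
Proof.
move=> h X; have [n] := ubnP #|[set Y | (X < Y)%O]%SET|.
elim: n X => // n IH X leX; apply: h => Y XY; apply: IH.
rewrite -ltnS; apply: leq_trans leX; rewrite ltnS; apply: proper_card;
  apply/properP; split.
  by apply/fintype.subsetP => Z; rewrite !inE; exact: lt_trans.
by exists Y; rewrite inE ?ltxx.
Qed.

Lemma covers_between (Y Z W : lattice A) : covers Y Z -> (Z < W)%O ->
  (W <= Y)%O -> W = Y.
Proof.
move=> /andP[_ /existsPn c] ZW; rewrite le_eqVlt => /orP[/eqP //|WY].
by have := c W; rewrite ZW WY.
Qed.

End LatticeInduction.

(** Only the recursion for the idempotents and the multiplicativity of the
    family of faces matter here, whence the general ring [B]. *)
Section Idempotents.
Context {R : realType} {d : nat} {A : arrangement R d} {B : pzRingType}.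
Context {r : lattice A -> face A} {b : face A -> B} {e : lattice A -> B}.
Hypothesis supp_r : forall X, supp (r X) = X.
Hypothesis bM : forall x y, b x * b y = b (face_mul x y).
Hypothesis eE :
  forall X, e X = b (r X) - \sum_(Y : lattice A | (X < Y)%O) b (r X) * e Y.
Implicit Types (x y z w : face A) (X Y Z W : lattice A).

Lemma face_idem X : b (r X) * e X = e X.
Proof.
rewrite eE mulrBr bM face_mulxx mulr_sumr; congr (_ - _).
by apply: eq_bigr => Y _; rewrite mulrA bM face_mulxx.
Qed.

(** The recursion gives this for the chosen face [r X]; a face [x] with the same
    support satisfies [x * r X = x]. *)
Lemma face_sum_idem x :
  b x = \sum_(Y | (supp x <= Y)%O) b x * e Y.
Proof.
have h X : b (r X) = \sum_(Y | (X <= Y)%O) b (r X) * e Y.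
  rewrite (bigD1 X) //= face_idem [in RHS]eE.
  rewrite (eq_bigl (fun Y => (X < Y)%O)) ?subrK // => Y.
  by rewrite lt_neqAle eq_sym andbC.
have -> : b x = b x * b (r (supp x)).
  by rewrite bM face_mul_supp ?supp_r.
rewrite {1}(h (supp x)) mulr_sumr; apply: eq_bigr => Y _.
by rewrite mulrA.
Qed.

(** With [c = w * r X], whose support is strictly above [X], the recursion gives
    [w * e X = c - sum_(Y > X) c * e Y].  By induction the terms with [Y] not
    above [supp c] vanish, and the others add up to [c] by [face_sum_idem]. *)
Lemma idem_kill w X : ~~ (supp w <= X)%O -> b w * e X = 0.
Proof.
move: X w; apply: lattice_ind_up => X IH w wX; pose c := face_mul w (r X).
have Xc : (X < supp c)%O.
  have := lexx (supp c); rewrite {1}/c supp_mul_le supp_r => /andP[wc Xc].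
  rewrite lt_neqAle Xc andbT; apply: contraNneq wX => ->; exact: wc.
rewrite eE mulrBr bM -/c mulr_sumr.
rewrite [X in _ - X](bigID (fun Y => (supp c <= Y)%O)) /=.
rewrite [X in _ - (_ + X)]big1 ?addr0 => [|Y /andP[XY cY]]; last first.
  by rewrite mulrA bM IH.
rewrite {1}(face_sum_idem c); apply/eqP; rewrite subr_eq0; apply/eqP.
apply: eq_big => [Y|Y _]; last by rewrite mulrA bM.
by apply/idP/andP => [cY|[]//]; split=> //; apply: lt_le_trans cY.
Qed.

Lemma idem_absorb w X : (supp w <= X)%O -> e X * b w = e X.
Proof.
move: X w; apply: lattice_ind_up => X IH w wX; rewrite eE mulrBl bM.
rewrite face_mul_supp ?supp_r //; congr (_ - _); rewrite mulr_suml.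
by apply: eq_bigr => Y XY; rewrite -mulrA IH // (le_trans wX) // ltW.
Qed.

Context {eps : lattice A -> seq 'rV[R]_d -> int}.
Hypothesis eps_orientation : forall X, orientation (lspace X) (eps X).
Hypothesis idem_idem : forall X, e X * e X = e X.

Lemma sum_covers_faces (V : zmodType) z Y (F : face A -> V) i :
  covers Y (supp z) -> in_hyperplane (supp z) i -> ~~ in_hyperplane Y i ->
  exists y1 y2, [/\ [/\ (z < y1)%O, supp y1 = Y & y1 i = Some true],
    [/\ (z < y2)%O, supp y2 = Y & y2 i = Some false],
    incidence eps z y2 = - incidence eps z y1
    & \sum_(y | (z < y)%O && (supp y == Y)) F y = F y1 + F y2].
Proof.
move=> Yz iz iY; have [y1 [y2 [h1 h2 h12 hy]]] :=
  covers_two_faces eps_orientation Yz iz iY.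
exists y1, y2; split=> //; have [zy1 y1Y y1i] := h1; have [zy2 y2Y y2i] := h2.
have y21 : y2 != y1 by apply: contra_eq_neq y1i => <-; rewrite y2i.
rewrite (bigD1 y1) ?zy1 ?y1Y ?eqxx //= (bigD1 y2) ?zy2 ?y2Y ?eqxx ?y21 //=.
rewrite big1 ?addr0 // => y /andP[/andP[/andP[zy /eqP yY] yy1] yy2].
by case: (hy y zy yY) => ey; [move: yy1 | move: yy2]; rewrite ey eqxx.
Qed.

Lemma sum_incidence z Y : covers Y (supp z) ->
  \sum_(y | (z < y)%O && (supp y == Y)) incidence eps z y = 0.
Proof.
move=> Yz; have [i /andP[iz iY]] := lt_hyperplane (covers_lt Yz).
have [y1 [y2 [_ _ opp ->]]] := sum_covers_faces (incidence eps z) Yz iz iY.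
by rewrite opp subrr.
Qed.

Lemma idem_face_idem Y Z x : covers Y Z -> (r Z < x)%O -> supp x = Y ->
  e Z * b x * e Y = b x * e Y - b (r Z) * e Y.
Proof.
move=> YZ zx xY; rewrite [e Z]eE !mulrBl bM face_mul_le ?ltW //.
congr (_ - _); rewrite !mulr_suml (bigD1 Y) ?covers_lt //= big1 ?addr0.
  by rewrite -!mulrA [e Y * (_ * _)]mulrA idem_absorb ?xY // idem_idem.
move=> W /andP[ZW WY]; rewrite -[e W](@idem_absorb (r W)) ?supp_r //.
rewrite -!mulrA [b (r W) * _]mulrA bM idem_kill ?mulr0 //.
rewrite supp_mul_le supp_r; apply: contra WY => /andP[WY _].
by apply/eqP; exact: covers_between YZ ZW WY.
Qed.

(** Faces over [r Z] whose support is not [Y] are killed by [e Y], and [e Z]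
    subtracts the same element [r Z * e Y] from every remaining term
    ([idem_face_idem]); these corrections cancel as the incidence numbers add
    up to zero. *)
Lemma arrow_image Y Z : covers Y Z ->
  e Z * (\sum_(x | covers x (r Z)) b x *~ incidence eps (r Z) x) * e Y =
  \sum_(x | (r Z < x)%O && (supp x == Y)) b x * e Y *~ incidence eps (r Z) x.
Proof.
move=> YZ; rewrite mulr_sumr mulr_suml.
transitivity (\sum_(x | (r Z < x)%O && (supp x == Y))
    (b x * e Y - b (r Z) * e Y) *~ incidence eps (r Z) x); last first.
  transitivity (\sum_(x | (r Z < x)%O && (supp x == Y))
    b x * e Y *~ incidence eps (r Z) x -
    b (r Z) * e Y *~
      (\sum_(x | (r Z < x)%O && (supp x == Y)) incidence eps (r Z) x)).
    rewrite mulrz_sumr -sumrB; apply: eq_bigr => x _; exact: mulrzBl.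
  by rewrite sum_incidence ?supp_r // mulr0z subr0.
rewrite (bigID (fun x => supp x == Y)) /= [X in _ + X]big1 ?addr0 =>
  [|x /andP[xz xY]].
  apply: eq_big => [x|x /andP[/andP[zx _] /eqP xY]].
    case: eqP => //= xY; rewrite ?andbT ?andbF //; apply/idP/idP => [/andP[]//|zx].
    apply/andP; split=> //; apply/existsPn => c; apply/negP => /andP[zc cx].
    have := covers_between YZ (W := supp c); have := lt_supp cx.
    have := lt_supp zc; rewrite supp_r xY => Zc cY /(_ Zc (ltW cY)) ecY.
    by move: cY; rewrite ecY ltxx.
  by rewrite mulrzAr mulrzAl (idem_face_idem YZ zx xY).
rewrite mulrzAr mulrzAl -mulrA idem_kill ?mulr0 ?mul0rz //.
apply: contra xY => xY; apply/eqP; apply: (covers_between YZ) => //.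
by have := lt_supp (proj1 (andP xz)); rewrite supp_r.
Qed.

Local Notation arrow Y Z :=
  (e Z * (\sum_(x | covers x (r Z)) b x *~ incidence eps (r Z) x) * e Y).

(** Multiplication by [y] maps the faces above [r Y] bijectively to the faces
    above [y], and preserves incidence numbers. *)
Lemma face_arrow y Y X : covers X Y -> supp y = Y ->
  b y * arrow X Y =
  \sum_(x | (y < x)%O && (supp x == X)) b x * e X *~ incidence eps y x.
Proof.
move=> XY yY; rewrite arrow_image // mulr_sumr.
have [i /andP[iY iX]] := lt_hyperplane (covers_lt XY).
have ry : face_mul (r Y) y = r Y by rewrite face_mul_supp // supp_r yY.
have yr : face_mul y (r Y) = y by rewrite face_mul_supp // supp_r yY.
have supp_ry x : supp (face_mul y x) = supp (face_mul (r Y) x).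
  by apply: supp_mul_congr; rewrite supp_r.
rewrite [RHS](reindex_onto (face_mul y) (face_mul (r Y))) /=; last first.
  by move=> x /andP[/ltW yx _]; rewrite face_mulA yr face_mul_le.
have rlt w x : (w <= x)%O -> supp w = Y -> supp x = X -> (w < x)%O.
  move=> wx wY xX; rewrite lt_neqAle wx andbT; apply: contraTneq (covers_lt XY).
  by rewrite -wY -xX => ->; rewrite ltxx.
apply: eq_big => [x|x /andP[rx /eqP xX]].
  apply/andP/andP => [[rx /eqP xX]|[/andP[_ /eqP yxX]]].
    have rxx : face_mul (r Y) x = x by rewrite face_mul_le // ltW.
    have yxX : supp (face_mul y x) = X by rewrite supp_ry rxx.
    split; last by rewrite face_mulA ry rxx.
    by apply/andP; split; [apply: rlt => //; exact: le_face_mull | exact/eqP].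
  rewrite face_mulA ry => /eqP rxx.
  have xX : supp x = X by rewrite -yxX supp_ry rxx.
  by split; [apply: rlt; rewrite ?supp_r // -rxx le_face_mull | exact/eqP].
have rxx : face_mul (r Y) x = x by rewrite face_mul_le // ltW.
have yxX : supp (face_mul y x) = X by rewrite supp_ry rxx.
rewrite mulrzAr mulrA bM; congr (_ *~ _).
rewrite (@incidence_compare _ _ _ _ eps_orientation (r Y) x y (face_mul y x) i)
  ?supp_r ?xX //.
rewrite face_mulE (_ : y i = None) ?eqxx ?mul1r //.
by apply/eqP; rewrite -in_hyperplane_supp yY.
Qed.

(** Exchanging the sums, every face above [r Z] of support [X] occurs with the
    coefficient computed in [incidence_flag_sum]. *)
Lemma arrow_comp_sum Z X : (Z < X)%O -> (exists Y, (Z < Y < X)%O) ->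
  (forall Y, (Z < Y < X)%O -> covers X Y /\ covers Y Z) ->
  \sum_(Y : lattice A | (Z < Y < X)%O) arrow Y Z * arrow X Y = 0.
Proof.
move=> ZX ex cov; pose z := r Z.
pose T y x := b x * e X *~ (incidence eps z y * incidence eps y x).
transitivity (\sum_(y | (z < y)%O && (supp y < X)%O)
                \sum_(x | (y < x)%O && (supp x == X)) T y x).
  rewrite [RHS](partition_big (@supp R d A) (fun Y : lattice A =>
    (Z < Y < X)%O)) /=; last first.
    by move=> y /andP[zy ->]; rewrite -(supp_r Z) lt_supp.
  apply: eq_bigr => Y ZYX; have [XY YZ] := cov _ ZYX.
  rewrite [arrow Y Z]arrow_image // mulr_suml; apply: eq_big =>
    [y|y /andP[zy /eqP yY]].
    by case: eqP => [->|]; rewrite ?andbF ?andbT //; case/andP: ZYX => _ ->;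
      rewrite andbT.
  rewrite mulrzAl -mulrA [e Y * _]mulrA [e Y * (_ * _)]mulrA idem_idem face_arrow
    //.
  rewrite mulrz_suml; apply: eq_bigr => x _; rewrite -mulrzA; congr (_ *~ _);
    exact: mulrC.
rewrite (exchange_big_dep (fun x => (z < x)%O && (supp x == X))) /=; last first.
  by move=> y x /andP[zy _] /andP[yx ->]; rewrite (lt_trans zy).
apply: big1 => x /andP[zx /eqP xX].
rewrite (eq_bigl (fun y => (z < y < x)%O)) => [|y]; last first.
  rewrite xX eqxx andbT; case: (z < y)%O => //=; apply/andP/idP => [[]//|yx].
  by rewrite -xX lt_supp.
by rewrite -mulrz_sumr incidence_flag_sum ?mulr0z // supp_r xX.
Qed.

End Idempotents.

Section FaceBasis.
Context {k : fieldType} {R : realType} {d : nat} {A : arrangement R d}.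
Implicit Types (u f : kF k A) (x y z w : face A) (X Y Z W : lattice A).

Lemma fbasis_mulU w c x :
  fbasis k w * (<< c *g x >> : {malg k[face A]}) =
  (<< c *g face_mul w x >> : {malg k[face A]}) :> kF k A.
Proof.
change (kF_mul (fbasis k w) << c *g x >> = << c *g face_mul w x >> :> kF k A).
by rewrite kF_mulE [LHS]fgmulUU mul1r.
Qed.

Lemma fbasis_mul_coef w u x : ~~ (w <= x)%O -> (fbasis k w * u)@_x = 0.
Proof.
move=> wx; rewrite [u]monalgE mulr_sumr raddf_sum /= big1 // => y _.
rewrite fbasis_mulU mcoeffU; case: eqP => // e.
by move: wx; rewrite -e le_face_mull.
Qed.

Lemma fbasis_coef x y : (fbasis k x)@_y = (x == y)%:R.
Proof. exact: mcoeffU. Qed.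

Context {r : lattice A -> face A}.
Hypothesis supp_r : forall X, supp (r X) = X.
Local Notation e_ X := (idem k r X).

(** The face [r X] has coefficient one in its idempotent: the other terms of the
    recursion are multiples of faces whose support is strictly above [X]. *)
Lemma idem_neq0 X : e_ X != 0.
Proof.
apply/eqP => /(congr1 (mcoeff (r X))); rewrite mcoeff0 idemE.
rewrite mcoeffB raddf_sum /= big1 => [|Y XY]; last first.
  rewrite -(face_idem (@fbasisM k R d A) (idemE k r) Y) mulrA fbasisM
    fbasis_mul_coef //.
  apply: contraL XY => /le_supp; rewrite supp_mul_le !supp_r => /andP[_ YX].
  by rewrite le_gtF.
by rewrite subr0 mcoeffUU => /eqP; rewrite oner_eq0.
Qed.

Context {eps : lattice A -> seq 'rV[R]_d -> int}.

Lemma boundary_fbasis z : boundary eps (fbasis k z) =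
  \sum_(x | covers x z) fbasis k x *~ incidence eps z x.
Proof.
rewrite /boundary.
under eq_bigr => y _ do rewrite fbasis_coef.
rewrite (bigD1 z) //= eqxx scale1r.
rewrite [X in _ + X = _]big1 => [|y yz]; last first.
  by rewrite eq_sym (negPf yz) scale0r.
rewrite addr0; under eq_bigr => x _ do rewrite scaler_int.
by [].
Qed.

End FaceBasis.

(** * Independence of the arrows into [Z] that avoid a hyperplane *)

Section Separation.
Context {R : realType} {d : nat} {A : arrangement R d} {B : pzRingType}.
Context {r : lattice A -> face A} {b : face A -> B} {e : lattice A -> B}.
Hypothesis supp_r : forall X, supp (r X) = X.
Hypothesis bM : forall x y, b x * b y = b (face_mul x y).
Hypothesis eE :
  forall X, e X = b (r X) - \sum_(Y : lattice A | (X < Y)%O) b (r X) * e Y.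
Context {eps : lattice A -> seq 'rV[R]_d -> int}.
Hypothesis eps_orientation : forall X, orientation (lspace X) (eps X).
Hypothesis idem_idem : forall X, e X * e X = e X.
Implicit Types (x y z w : face A) (X Y Z W : lattice A).
Local Notation arrow Y Z :=
  (e Z * (\sum_(x | covers x (r Z)) b x *~ incidence eps (r Z) x) * e Y).

Context {Z : lattice A} {i : 'I_(hcount A)} {f : lattice A -> B}.
Hypothesis fE : forall Y, e Y * f Y = f Y.
Let above x := [&& (r Z < x)%O, covers (supp x) Z & x i != None].
Let term x := b x * (f (supp x) *~ incidence eps (r Z) x).

(** The faces above [r Z] that contribute to the arrows from the [Y] outside
    hyperplane [i] are exactly those off this hyperplane; the sum splits according
    to its two sides. *)
Lemma arrow_sum_faces :
  \sum_(Y | covers Y Z && ~~ in_hyperplane Y i) arrow Y Z * f Y =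
  \sum_(x | above x && (x i == Some true)) term x +
  \sum_(x | above x && ~~ (x i == Some true)) term x.
Proof.
rewrite -bigID /= [RHS](partition_big (@supp R d A)
  (fun Y => covers Y Z && ~~ in_hyperplane Y i)) /=; last first.
  by move=> x; rewrite /above in_hyperplane_supp => /and3P[_ -> ->].
apply: eq_bigr => Y /andP[YZ iY]; rewrite (arrow_image (e := e)) // mulr_suml.
apply: eq_big => [x|x /andP[_ /eqP xY]].
  rewrite /above -in_hyperplane_supp; case: (supp x =P Y) => [->|_];
    last by rewrite !andbF.
  by rewrite YZ iY !andbT.
by rewrite mulrzAl -mulrA fE /term xY mulrzAr.
Qed.

(** Let [y] be the face of support [Y] above [r Z] on the positive side.
    Multiplying by [y] kills every term with another support [Y'], since
    [supp (y * x)] is not below [Y'] and [f Y' = e Y' * f Y']; what remains is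
    [y * f Y] up to sign, and [e Y * y = e Y]. *)
Lemma half_sum_eq0 Y : in_hyperplane Z i -> covers Y Z -> ~~ in_hyperplane Y i ->
  \sum_(x | above x && (x i == Some true)) term x = 0 -> f Y = 0.
Proof.
move=> iZ YZ iY; have YZ' : covers Y (supp (r Z)) by rewrite supp_r.
have iZ' : in_hyperplane (supp (r Z)) i by rewrite supp_r.
have [y [_ [[zy yY yi] _ _ _]]] := covers_two_faces eps_orientation YZ' iZ' iY.
have yab : above y && (y i == Some true) by rewrite /above zy yY YZ yi.
move/(congr1 ( *%R (b y))); rewrite mulr0 mulr_sumr (bigD1 y) //= big1 ?addr0.
  rewrite /term mulrA bM face_mulxx yY => yf.
  have {}yf : b y * f Y = 0.
    move: yf; have := incidence_pm eps_orientation (x := r Z) (y := y).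
    rewrite supp_r yY => /(_ YZ) [] -> //.
    by rewrite mulrN1z mulrN => /eqP; rewrite oppr_eq0 => /eqP.
  by rewrite -fE -(idem_absorb supp_r bM eE (w := y)) ?yY // -mulrA yf mulr0.
rewrite /above => x /andP[/andP[/and3P[zx xZ xi] /eqP xit] xy].
rewrite /term mulrA bM -fE -mulrzAr mulrA (idem_kill supp_r bM eE) ?mul0r //.
rewrite supp_mul_le; apply: contra xy => /andP[yx _]; apply/eqP/esym.
have exy : supp x = supp y.
  by apply/esym/(covers_between xZ) => //; rewrite yY covers_lt.
apply: (@covers_face_eq _ _ _ (r Z) y x i) => //; rewrite ?exy ?yY ?supp_r //.
by rewrite yi xit.
Qed.

End Separation.

Section SeparationFace.
Context {k : fieldType} {R : realType} {d : nat} {A : arrangement R d}.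

(** A left multiple of [x] only involves faces above [x], so the two sums are
    supported on opposite sides of hyperplane [i]. *)
Lemma fbasis_half_sum i (P : pred (face A)) (g : face A -> kF k A) :
  (forall x, P x -> x i != None) ->
  \sum_(x | P x && (x i == Some true)) fbasis k x * g x +
  \sum_(x | P x && ~~ (x i == Some true)) fbasis k x * g x = 0 ->
  \sum_(x | P x && (x i == Some true)) fbasis k x * g x = 0.
Proof.
move=> Pi; set u := \sum_(x | _) _; set v := (X in _ + X) => uv.
have coef0 (Q : pred (face A)) (w : face A) : (forall x, Q x -> x i != None) ->
    (forall x, Q x -> x i != w i) -> (\sum_(x | Q x) fbasis k x * g x)@_w = 0.
  move=> Qi Qw; rewrite (raddf_sum (mcoeff w)) big1 // => x Qx.
  apply: fbasis_mul_coef; apply/negP => /face_leP/(_ i (Qi x Qx)) e.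
  by have := Qw x Qx; rewrite e eqxx.
apply/malgP => w; rewrite mcoeff0; have [wi|wi] := eqVneq (w i) (Some true).
  have /(congr1 (mcoeff w)) := uv; rewrite mcoeffD mcoeff0.
  rewrite [X in _ + X]coef0 ?addr0 // => x /andP[/Pi] //.
  by rewrite wi.
apply: coef0 => x /andP[/Pi // _ /eqP ->]; by rewrite eq_sym.
Qed.

End SeparationFace.

(** * Path algebras *)

Section PathAlgebraTheory.
Context {V : finType} {e : rel V} {k : comNzRingType}.
Local Notation B := (pathalg e k).
Implicit Types (p q : qpath e) (x y z : V) (u v a b : B).
Local Notation path1 c p := (<< c *g p >> : {malg k[qpath e]}).
Local Notation "[vtx x ]" := (pathelt e k x [::]) (at level 0).
Local Notation arr x y := (pathelt e k x [:: y]).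

Lemma path1M c c' p q :
  (path1 c p : B) * path1 c' q = pbasis (c * c') (qcomp p q).
Proof. exact: pamulUU. Qed.

Lemma patheltE p : pathelt e k (qsrc p) p.2 = path1 1 p :> B.
Proof.
rewrite /pathelt; case: insubP => [q _ qp|]; last first.
  by have := valP p; rewrite /= => ->.
by congr (mkmalgU _ _); apply: val_inj; rewrite /= qp -surjective_pairing.
Qed.

Lemma pathelt_cat x s t : path e x (s ++ t) ->
  pathelt e k (last x s) t * pathelt e k x s = pathelt e k x (s ++ t).
Proof.
move=> pst; have := pst; rewrite cat_path => /andP[ps pt].
pose p := @QPath _ e (x, s) ps; pose q := @QPath _ e (last x s, t) pt.
pose pq := @QPath _ e (x, s ++ t) pst.
rewrite (patheltE q) (patheltE p) (patheltE pq) path1M mulr1.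
by rewrite (@qcomp_some _ _ q p pq).
Qed.

Lemma vtxE x : [vtx x] = path1 1 (qvertex e x).
Proof. exact: (patheltE (qvertex e x)). Qed.

Lemma vtx_path1 x c p : [vtx x] * path1 c p = if x == qtgt p then path1 c p else 0.
Proof. by rewrite vtxE path1M mul1r qcomp_vl; case: eqP. Qed.

Lemma path1_vtx x c p : (path1 c p : B) * [vtx x] =
  if x == qsrc p then path1 c p else 0.
Proof. by rewrite vtxE path1M mulr1 qcomp_vr; case: eqP. Qed.

Lemma vtxM x y : [vtx x] * [vtx y] = if x == y then [vtx x] else 0.
Proof. by rewrite [X in _ * X]vtxE vtx_path1 -vtxE /=; case: eqP => // ->. Qed.

Lemma sum_vtx : \sum_x [vtx x] = 1 :> B.
Proof. by apply: eq_bigr => x _; rewrite vtxE. Qed.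

Lemma vtx_arr x y : e x y -> [vtx y] * arr x y = arr x y.
Proof.
by move=> xy; have := @pathelt_cat x [:: y] [::]; rewrite cats0 /= xy; apply.
Qed.

Lemma arr_vtx x y : e x y -> arr x y * [vtx x] = arr x y.
Proof.
by move=> xy; have := @pathelt_cat x [::] [:: y]; rewrite /= xy; apply.
Qed.

Lemma pathalgP (P : B -> Prop) : P 0 -> (forall u v, P u -> P v -> P (u + v)) ->
  (forall c p, P (path1 c p)) -> forall u, P u.
Proof.
move=> P0 PD P1 u; rewrite [u]monalgE.
by apply: (big_ind P) => // p _; apply: P1.
Qed.

Lemma comp_coef x y u p :
  ([vtx y] * u * [vtx x])@_p = if (qtgt p == y) && (qsrc p == x) then u@_p else 0.
Proof.
elim/pathalgP: u => [|u v IHu IHv|c q].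
- by rewrite mulr0 mul0r mcoeff0 if_same.
- rewrite mulrDr mulrDl !mcoeffD IHu IHv; case: ifP => // _; exact: addr0.
rewrite vtx_path1; have [->|yq] := eqVneq y (qtgt q); last first.
  rewrite mul0r mcoeff0 mcoeffU; case: (q =P p) => [<-|];
    rewrite ?mulr0n ?if_same //.
  by rewrite eq_sym (negPf yq).
rewrite path1_vtx; have [->|xq] := eqVneq x (qsrc q); last first.
  rewrite mcoeff0 mcoeffU; case: (q =P p) => [<-|]; rewrite ?mulr0n ?if_same //.
  by rewrite [_ == x]eq_sym (negPf xq) andbF.
by rewrite mcoeffU; case: (q =P p) => [<-|]; rewrite ?eqxx ?mulr0n ?if_same.
Qed.

Lemma comp_eq0 x y u : (forall s, path e x s -> last x s != y) ->
  [vtx y] * u * [vtx x] = 0.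
Proof.
move=> h; apply/malgP => p; rewrite comp_coef mcoeff0.
case: ifP => // /andP[/eqP py /eqP px].
by have := h p.2; rewrite -px (valP p) -/(qtgt p) py eqxx => /(_ isT).
Qed.

(** The product with [vtx z] keeps the paths that end at [z], and a path of
    positive length is the product of its last arrow and a shorter path. *)
Lemma vtx_decomp u z : exists (c : k) (w : V -> B),
  [vtx z] * u = c *: [vtx z] + \sum_(y | e y z) arr y z * w y.
Proof.
elim/pathalgP: u => [|u v [c [w hu]] [c' [w' hv]]|c p].
- by exists 0, (fun=> 0); rewrite mulr0 scale0r big1 ?addr0 // => y _;
  rewrite mulr0.
- exists (c + c'), (fun y => w y + w' y); rewrite mulrDr hu hv scalerDl addrACA.
  by congr (_ + _); rewrite -big_split; apply: eq_bigr => y _; rewrite mulrDr.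
rewrite vtx_path1; case: eqP => [zp|_]; last first.
  by exists 0, (fun=> 0); rewrite scale0r big1 ?addr0 // => y _; rewrite mulr0.
case: p zp => [[x s] /= ps]; rewrite /qtgt /=.
case/lastP: s ps => [|s z'] ps.
  move=> zx; exists c, (fun=> 0); rewrite big1 ?addr0 => [|y _];
    last by rewrite mulr0.
  rewrite vtxE; apply/malgP => q; rewrite mcoeffZ !mcoeffU zx.
  rewrite (_ : @QPath _ e (x, [::]) ps = qvertex e x) ?mulr_natr //; exact: val_inj.
rewrite last_rcons => ->.
have := ps; rewrite /= rcons_path => /andP[ps' yz].
pose q := @QPath _ e (x, s) ps'.
have ty : path e (last x s) [:: z'] by rewrite /= yz.
exists 0, (fun y => if y == last x s then path1 c q else 0); rewrite scale0r add0r.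
rewrite (bigD1 (last x s)) //= eqxx big1 ?addr0 => [|y /andP[_ /negPf ->]];
  last by rewrite mulr0.
rewrite (patheltE (@QPath _ e (last x s, [:: z']) ty)) path1M mul1r.
by rewrite (@qcomp_some _ _ _ q (@QPath _ e (x, rcons s z') ps)) //= cats1.
Qed.

Definition vanishing (K : qpath e -> Prop) : set B :=
  [set u | forall p, K p -> u@_p = 0]%classic.

(** If [K] contains the factors of its paths, the coefficient of a product on a
    path of [K] only involves coefficients of the factors on paths of [K]. *)
Lemma vanishing_ideal (K : qpath e -> Prop) :
  (forall p q s, qcomp p q = Some s -> K s -> K p /\ K q) ->
  two_sided_ideal (vanishing K).
Proof.
move=> fK; split=> [p _|u v hu hv p Kp|a u b hu].
- exact: mcoeff0.
- by rewrite mcoeffD hu // hv // addr0.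
have cf c (o : option (qpath e)) s : o <> Some s ->
  (pbasis c o : {malg k[qpath e]})@_s = 0.
  case: o => [t|] ne /=; last exact: mcoeff0.
  by rewrite mcoeffU; case: eqP => // ts; case: ne; rewrite ts.
have hau : vanishing K (a * u).
  move=> s Ks; rewrite -[a * u]/(pamul a u) pamulE.
  rewrite (raddf_sum (mcoeff s)) big1 // => p _.
  rewrite (raddf_sum (mcoeff s)) big1 // => q _.
  have [pq|pq] := eqVneq (qcomp p q) (Some s); last by apply/cf/eqP.
  have [_ Kq] := fK _ _ _ pq Ks; rewrite (hu _ Kq) mulr0 pbasis0; exact: mcoeff0.
move=> s Ks; rewrite -[a * u * b]/(pamul (a * u) b) pamulE.
rewrite (raddf_sum (mcoeff s)) big1 // => p _.
rewrite (raddf_sum (mcoeff s)) big1 // => q _.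
have [pq|pq] := eqVneq (qcomp p q) (Some s); last by apply/cf/eqP.
have [Kp _] := fK _ _ _ pq Ks; rewrite (hau _ Kp) mul0r pbasis0; exact: mcoeff0.
Qed.

End PathAlgebraTheory.

(** * Intervals of length two *)

Section IntervalLength.
Context {disp : Order.disp_t} {T : finPOrderType disp}.
Implicit Types (X Y Z W : T).

Lemma chain_interval_length Z X (C : {set T}) :
  chain C -> C \subset [set y | (Z <= y <= X)%O] ->
  (#|C|.-1 <= interval_length Z X)%N.
Proof. by move=> cC sC; apply: bigop.leq_bigmax_cond; rewrite cC sC. Qed.

Lemma interval_length_chain Z X : exists C : {set T},
  [/\ chain C, C \subset [set y | (Z <= y <= X)%O] &
      #|C|.-1 = interval_length Z X].
Proof.
pose P : pred {set T} :=
  fun C => chain C && (C \subset [set y | (Z <= y <= X)%O]).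
have P0 : P finset.set0.
  by rewrite /P finset.sub0set andbT; apply/forallP => U; rewrite inE.
have -> : interval_length Z X = (\max_(C | P C) #|C|.-1)%N by [].
rewrite (@bigop.bigmax_eq_arg _ finset.set0 P _ P0).
by case: arg_maxnP => // C /andP[cC sC] _; exists C.
Qed.

Lemma chain3_interval_length Z Y Y' X : (Z < Y)%O -> (Y < Y')%O -> (Y' < X)%O ->
  (3 <= interval_length Z X)%N.
Proof.
move=> ZY YY' Y'X.
have ZY' := lt_trans ZY YY'; have YX := lt_trans YY' Y'X; have ZX := lt_trans ZY YX.
have c4 : chain [set U in [:: Z; Y; Y'; X]].
  apply/forallP => U; apply/implyP; rewrite !inE => hU.
  apply/forallP => U'; apply/implyP; rewrite !inE => hU'.
  by case/or4P: hU => /eqP ->; case/or4P: hU' => /eqP ->;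
    rewrite /Order.comparable ?lexx ?(ltW ZY) ?(ltW ZY') ?(ltW ZX) ?(ltW YY')
      ?(ltW YX) ?(ltW Y'X) ?orbT.
have sub : [set U in [:: Z; Y; Y'; X]] \subset [set y | (Z <= y <= X)%O].
  apply/fintype.subsetP => U; rewrite !inE => /or4P[] /eqP ->;
  by rewrite ?lexx ?(ltW ZY) ?(ltW ZY') ?(ltW ZX) ?(ltW YX) ?(ltW Y'X).
have := chain_interval_length c4 sub; rewrite cardsE (card_uniqP _) //= !inE.
by rewrite (lt_eqF ZY) (lt_eqF ZY') (lt_eqF ZX) (lt_eqF YY') (lt_eqF YX)
  (lt_eqF Y'X).
Qed.

Lemma chain2_interval_length Z Y X : (Z < Y)%O -> (Y < X)%O ->
  (2 <= interval_length Z X)%N.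
Proof.
move=> ZY YX; have ZX := lt_trans ZY YX.
have c3 : chain [set U in [:: Z; Y; X]].
  apply/forallP => U; apply/implyP; rewrite !inE => hU.
  apply/forallP => U'; apply/implyP; rewrite !inE => hU'.
  by case/or3P: hU => /eqP ->; case/or3P: hU' => /eqP ->;
    rewrite /Order.comparable ?lexx ?(ltW ZY) ?(ltW ZX) ?(ltW YX) ?orbT.
have sub : [set U in [:: Z; Y; X]] \subset [set y | (Z <= y <= X)%O].
  apply/fintype.subsetP => U; rewrite !inE => /or3P[] /eqP ->;
  by rewrite ?lexx ?(ltW ZY) ?(ltW ZX) ?(ltW YX).
have := chain_interval_length c3 sub; rewrite cardsE (card_uniqP _) //= !inE.
by rewrite (lt_eqF ZY) (lt_eqF ZX) (lt_eqF YX).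
Qed.

Lemma interval_length2_between Z X : interval_length Z X = 2%N ->
  exists Y, (Z < Y < X)%O.
Proof.
move=> len; have [C [cC sC]] := interval_length_chain Z X; rewrite len => C2.
have C3 : #|C| = 3%N by case: #|C| C2 => [|n] //= ->.
have [Y] : exists Y, Y \in C :\: [set Z; X].
  apply/card_gt0P; rewrite cardsD subn_gt0 C3 ltnS.
  apply: leq_trans (subset_leq_card (finset.subsetIr _ _)) _.
  by rewrite cards2; case: (Z == X).
rewrite inE in_set2 negb_or => /andP[/andP[YZ YX] YC]; exists Y.
have : Y \in [set y | (Z <= y <= X)%O] by move: YC; apply/fintype.subsetP.
rewrite inE => /andP[ZY YX']; apply/andP; split; rewrite lt_neqAle.
  by rewrite eq_sym YZ.
by rewrite YX.
Qed.

Lemma interval_length2_covers Z X Y : interval_length Z X = 2%N ->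
  (Z < Y < X)%O -> covers X Y /\ covers Y Z.
Proof.
move=> len /andP[ZY YX]; rewrite /covers ZY YX; split; apply/existsPn => U;
  apply/negP => /andP[].
- by move=> YU UX; have := chain3_interval_length ZY YU UX; rewrite len.
- by move=> ZU UY; have := chain3_interval_length ZU UY YX; rewrite len.
Qed.

Lemma interval_length_rank (f : T -> nat) Z X :
  (forall U U', (U < U')%O -> (f U < f U')%N) ->
  (interval_length Z X <= f X - f Z)%N.
Proof.
move=> f_lt; have f_le U U' : (U <= U')%O -> (f U <= f U')%N.
  by rewrite le_eqVlt => /orP[/eqP -> //|/f_lt/ltnW].
apply/bigop.bigmax_leqP => C /andP[/forallP cC sC].
have fC U : U \in C -> (f Z <= f U <= f X)%N.
  move=> UC; have : U \in [set y | (Z <= y <= X)%O] by move: UC;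
    apply/fintype.subsetP.
  by rewrite inE => /andP[ZU UX]; rewrite !f_le.
pose g U : 'I_(f X - f Z).+1 := inord (f U - f Z).
have gI : {in C &, injective g}.
  move=> U U' UC U'C; have /andP[h1 h2] := fC U UC; have /andP[h3 h4] := fC U' U'C.
  move=> /(congr1 val); rewrite /g /= !inordK ?ltnS ?leq_sub2r // => e.
  have {}e : f U = f U' by rewrite -(subnK h1) e subnK.
  have := cC U; rewrite UC /= => /forallP/(_ U'); rewrite U'C /=.
  have key S S' : (S <= S')%O -> f S = f S' -> S = S'.
    by rewrite le_eqVlt => /orP[/eqP //|/f_lt + eS]; rewrite eS ltnn.
  by case/orP => h; [exact: key | exact/esym/key].
have := max_card (mem (g @: C)); rewrite (card_in_imset gI) card_ord => leC.
by case: #|C| leC.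
Qed.

End IntervalLength.

Section LatticeIntervalLength.
Context {R : realType} {d : nat} {A : arrangement R d}.
Implicit Types (X Y Z W : lattice A).

(** The dimension is a rank function, so two consecutive covers bound an
    interval of length exactly two, whatever the other chains are. *)
Lemma covers_interval_length2 W Y Z : covers W Y -> covers Y Z ->
  interval_length Z W = 2%N.
Proof.
move=> WY YZ; apply/eqP; rewrite eqn_leq; apply/andP; split.
  apply: leq_trans (interval_length_rank Z W (@lattice_dim_lt _ _ A)) _.
  by rewrite (covers_dim WY) (covers_dim YZ) -addn2 addKn.
exact: chain2_interval_length (covers_lt YZ) (covers_lt WY).
Qed.

End LatticeIntervalLength.

(** * The kernel is generated by the relations *)

Section IdealTheory.
Context {Q : pzRingType} {I : set Q}.
Hypothesis idI : two_sided_ideal I.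
Implicit Types u v a : Q.

Lemma ideal0 : I 0. Proof. by case: idI. Qed.

Lemma idealD u v : I u -> I v -> I (u + v).
Proof. by case: idI => _ h _; apply: h. Qed.

Lemma idealMl a u : I u -> I (a * u).
Proof. by case: idI => _ _ h /(h a _ 1); rewrite mulr1. Qed.

Lemma idealMr a u : I u -> I (u * a).
Proof. by case: idI => _ _ h /(h 1 _ a); rewrite mul1r. Qed.

Lemma idealN u : I u -> I (- u).
Proof. by move=> /(idealMl (-1)); rewrite mulN1r. Qed.

Lemma ideal_sum (J : Type) (s : seq J) (P : pred J) (F : J -> Q) :
  (forall j, P j -> I (F j)) -> I (\sum_(j <- s | P j) F j).
Proof. by move=> h; apply: big_ind => //; [exact: ideal0 | exact: idealD]. Qed.

End IdealTheory.

(** The vertices and arrows only enter through the properties below: the last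
    arrow can be split off, the relations belong to the ideal [I], and arrows
    into [Z] that avoid a hyperplane have independent images ([phi_sep]). *)
Section Kernel.
Context {k : fieldType} {R : realType} {d : nat} {A : arrangement R d}.
Context {Q B : lalgType k} {phi : {lrmorphism Q -> B}}.
Implicit Types (X Y Z W : lattice A) (u v : Q) (i : 'I_(hcount A)).
Context {vt : lattice A -> Q} {ar : lattice A -> lattice A -> Q}.
Hypothesis vtM : forall X Y, vt X * vt Y = if X == Y then vt X else 0.
Hypothesis vt_sum : \sum_X vt X = 1.
Hypothesis vt_ar : forall X Y, covers X Y -> vt Y * ar X Y = ar X Y.
Hypothesis ar_vt : forall X Y, covers X Y -> ar X Y * vt X = ar X Y.
Hypothesis vt_decomp : forall u Z, exists (c : k) (w : lattice A -> Q),
  vt Z * u = c *: vt Z + \sum_(Y | covers Y Z) ar Y Z * w Y.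
Hypothesis vt_le : forall X Y u, ~~ (Y <= X)%O -> vt Y * u * vt X = 0.
Context {I : set Q}.
Hypothesis idI : two_sided_ideal I.
Hypothesis I_rel : forall W Y Z, covers W Y -> covers Y Z ->
  I (\sum_(Y' : lattice A | (Z < Y' < W)%O) ar Y' Z * ar W Y').

(** Modulo [I], all paths of [u] enter [Z] from outside hyperplane [i]. *)
Definition reducible Z i u := exists w : lattice A -> Q,
  I (u - \sum_(Y | covers Y Z && ~~ in_hyperplane Y i) ar Y Z * w Y).

Lemma reducible_ideal Z i u : I u -> reducible Z i u.
Proof. by exists (fun=> 0); rewrite big1 ?subr0 // => Y _; rewrite mulr0. Qed.

Lemma reducibleD Z i u v : reducible Z i u -> reducible Z i v ->
  reducible Z i (u + v).
Proof.
move=> [w hw] [w' hw']; exists (fun Y => w Y + w' Y).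
under eq_bigr => Y _ do rewrite mulrDr.
by rewrite big_split /= opprD addrACA; apply: idealD.
Qed.

Lemma reducibleN Z i u : reducible Z i u -> reducible Z i (- u).
Proof.
move=> [w hw]; exists (fun Y => - w Y); under eq_bigr => Y _ do rewrite mulrN.
by rewrite sumrN -opprD; apply: idealN.
Qed.

Lemma reducible_sum Z i (P : pred (lattice A)) F :
  (forall Y, P Y -> reducible Z i (F Y)) -> reducible Z i (\sum_(Y | P Y) F Y).
Proof.
move=> h; apply: big_ind => //; last exact: reducibleD.
by apply: reducible_ideal; exact: ideal0.
Qed.

Lemma reducible_arrow Z i Y v : covers Y Z -> ~~ in_hyperplane Y i ->
  reducible Z i (ar Y Z * v).
Proof.
move=> YZ iY; exists (fun Y' => if Y' == Y then v else 0).
rewrite (bigD1 Y) ?YZ //= eqxx big1 ?addr0 ?subrr; first exact: ideal0.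
by move=> Y' /andP[_ /negPf ->]; rewrite mulr0.
Qed.

(** In the relation of the interval from [Z] to [W], the path through [Y] is the
    only one that passes inside hyperplane [i], by [covers_hyperplane]. *)
Lemma reducible_arrow2 W Y Z i v : covers W Y -> covers Y Z ->
  in_hyperplane Y i -> ~~ in_hyperplane W i ->
  reducible Z i (ar Y Z * (ar W Y * v)).
Proof.
move=> WY YZ iY iW; have S := I_rel WY YZ.
have ZYW : (Z < Y < W)%O by rewrite !covers_lt.
have -> : ar Y Z * (ar W Y * v) =
    (\sum_(Y' : lattice A | (Z < Y' < W)%O) ar Y' Z * ar W Y') * v -
    \sum_(Y' : lattice A | (Z < Y' < W)%O && (Y' != Y)) ar Y' Z * (ar W Y' * v).
  rewrite mulr_suml (bigD1 Y) //= -[LHS]addr0 -mulrA -addrA; congr (_ + _).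
  by apply/esym/eqP; rewrite subr_eq0; apply/eqP/eq_bigr => Y' _; rewrite mulrA.
apply: reducibleD; first by apply/reducible_ideal/idealMr.
apply/reducibleN/reducible_sum => Y' /andP[ZY'W Y'Y].
have [WY' Y'Z] := interval_length2_covers (covers_interval_length2 WY YZ) ZY'W.
apply: reducible_arrow => //; apply: contra Y'Y => iY'.
by apply/eqP; apply: (covers_hyperplane WY' WY iW).
Qed.

Lemma reducible_hom Z X i u : in_hyperplane Z i -> ~~ in_hyperplane X i ->
  reducible Z i (vt Z * u * vt X).
Proof.
move: Z u; apply: lattice_ind_up => Z IH u iZ iX.
have [c [w ->]] := vt_decomp u Z; rewrite mulrDl -scalerAl vtM.
have /negPf -> : Z != X by apply: contraNneq iX => <-.
rewrite scaler0 add0r mulr_suml; apply: reducible_sum => Y YZ; rewrite -mulrA.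
have [iY|iY] := boolP (in_hyperplane Y i); last exact: reducible_arrow.
have [w' hw'] := IH Y (covers_lt YZ) (w Y) iY iX.
rewrite -(vt_ar YZ) in hw' *; rewrite (vt_ar YZ).
have -> : ar Y Z * (w Y * vt X) = ar Y Z * (vt Y * w Y * vt X).
  by rewrite -{1}(ar_vt YZ) -!mulrA.
set s := \sum_(_ | _) _ in hw'.
rewrite -(subrK s (vt Y * w Y * vt X)) mulrDr; apply: reducibleD.
  by apply/reducible_ideal/idealMl.
rewrite /s mulr_sumr; apply: reducible_sum => W /andP[WY iW].
exact: reducible_arrow2.
Qed.

Hypothesis I_ker : forall u, I u -> phi u = 0.
Hypothesis phi_vt : forall (c : k) Z, c *: phi (vt Z) = 0 -> c = 0.
Hypothesis phi_sep : forall Z i (f : lattice A -> B), in_hyperplane Z i ->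
  (forall Y, phi (vt Y) * f Y = f Y) ->
  \sum_(Y | covers Y Z && ~~ in_hyperplane Y i) phi (ar Y Z) * f Y = 0 ->
  forall Y, covers Y Z -> ~~ in_hyperplane Y i -> f Y = 0.

(** A hyperplane that contains [Z] but not [X] exists unless [X] lies below [Z];
    there, the component is zero unless [X = Z], and then it is a multiple of the
    vertex [Z], whose image is nonzero. *)
Lemma ker_hom Z X u : phi (vt Z * u * vt X) = 0 -> I (vt Z * u * vt X).
Proof.
move: Z X u; apply: lattice_ind_up => Z IH X u; set a := _ * vt X => a0.
have aX : a * vt X = a by rewrite /a -mulrA vtM eqxx.
have [/existsP[i /andP[iZ iX]]|] :=
  boolP [exists i, in_hyperplane Z i && ~~ in_hyperplane X i].
  have [w hw] := reducible_hom u iZ iX; rewrite -/a in hw.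
  pose f Y := vt Y * w Y * vt X.
  have sumE : (\sum_(Y | covers Y Z && ~~ in_hyperplane Y i) ar Y Z * w Y) * vt X
      = \sum_(Y | covers Y Z && ~~ in_hyperplane Y i) ar Y Z * f Y.
    rewrite mulr_suml; apply: eq_bigr => Y /andP[YZ _].
    by rewrite /f -{1}(ar_vt YZ) -!mulrA.
  have {}hw := idealMr idI (vt X) hw; rewrite mulrBl aX sumE in hw.
  rewrite -(subrK (\sum_(Y | covers Y Z && ~~ in_hyperplane Y i) ar Y Z * f Y) a).
  apply: idealD => //; apply: ideal_sum => // Y /andP[YZ iY].
  apply: idealMl => //; apply: IH; first exact: covers_lt.
  apply: (phi_sep (f := fun Y => phi (f Y)) iZ _ _ YZ iY).
    by move=> Y'; rewrite -rmorphM /f !mulrA vtM eqxx.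
  have := I_ker hw; rewrite rmorphB /= a0 sub0r => /eqP;
    rewrite oppr_eq0 => /eqP s0.
  rewrite -[RHS]s0 rmorph_sum /=; apply: eq_bigr => Y1 _; exact/esym/rmorphM.
rewrite negb_exists => /forallP h; have XZ : (X <= Z)%O.
  by apply/lattice_leP => i iZ; have := h i; rewrite iZ negbK.
suff -> : a = 0 by exact: ideal0.
have [ZX|] := boolP (Z <= X)%O; last exact: vt_le.
have eX : X = Z by apply/le_anti; rewrite XZ.
have [c [w e]] := vt_decomp u Z.
have ac : a = c *: vt Z.
  rewrite /a eX e mulrDl -scalerAl vtM eqxx mulr_suml big1 ?addr0 // => Y YZ.
  by rewrite -(ar_vt YZ) -!mulrA [vt Y * _]mulrA vt_le ?mulr0 // lt_geF ?covers_lt.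
by move: a0; rewrite ac linearZ /= => /phi_vt ->; rewrite scale0r.
Qed.

Lemma ker_sub_ideal u : phi u = 0 -> I u.
Proof.
move=> u0; rewrite -[u]mul1r -[_ * u]mulr1 -vt_sum mulr_sumr.
apply: ideal_sum => // X _; rewrite !mulr_suml; apply: ideal_sum => // Z _.
by apply: ker_hom; rewrite !rmorphM /= u0 mulr0 mul0r.
Qed.

End Kernel.

(** * The quiver algebra of the lattice *)

Section IdealGen.
Context {Q : pzRingType}.
Implicit Types (S I : set Q).

Lemma ideal_gen_ideal S : two_sided_ideal (ideal_gen S).
Proof.
split=> [J [[]] //|u v uS vS J|a u b uS J] /= hJ; have [[J0 JD JM] _] := hJ.
- by apply: JD; [exact: uS | exact: vS].
- by apply: JM; exact: uS.
Qed.

End IdealGen.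

Section Relations.
Context {k : fieldType} {R : realType} {d : nat} {A : arrangement R d}.
Implicit Types (X Y Z W : lattice A).
Local Notation e := (fun X Y : lattice A => covers X Y).

Lemma qpathelt_comp X Y Z : covers X Y -> covers Y Z ->
  qpathelt k X [:: Y; Z] = qpathelt k Y [:: Z] * qpathelt k X [:: Y].
Proof.
move=> XY YZ; have := @pathelt_cat _ e k X [:: Y] [:: Z].
by rewrite /= XY YZ => /(_ isT) h; exact/esym/h.
Qed.

Lemma path_covers_le X s : path e X s -> (last X s <= X)%O.
Proof.
by elim: s X => //= Y s IH X /andP[XY /IH YX]; apply: le_trans YX _;
  exact/ltW/covers_lt.
Qed.

Lemma qpathelt_coef X s (p : qpath e) : path e X s ->
  (qpathelt k X s : {malg k[qpath e]})@_p = ((X, s) == qval p)%:R.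
Proof.
move=> ps; have -> : qpathelt k X s = << @QPath _ e (X, s) ps >>.
  exact: (@patheltE _ e k (@QPath _ e (X, s) ps)).
by rewrite mcoeffU.
Qed.

Lemma two_path_sum_coef Z X (p : qpath e) : interval_length Z X = 2%N ->
  (two_path_sum k Z X : {malg k[qpath e]})@_p =
  ((size p.2 == 2%N) && (qsrc p == X) && (qtgt p == Z))%:R.
Proof.
move=> len; rewrite /two_path_sum (raddf_sum (mcoeff p)).
have pathP Y : (Z < Y < X)%O -> path e X [:: Y; Z].
  by move/(interval_length2_covers len) => /= [-> ->].
rewrite (eq_bigr (fun Y => ((X, [:: Y; Z]) == qval p)%:R)) => [|Y /pathP ps];
  last first.
  exact: qpathelt_coef.
case: p => -[x s] /= ps; rewrite /qsrc /qtgt /=.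
case: s ps => [|Y [|Z' [|? ?]]] ps; rewrite /= ?andbF;
  try by rewrite big1 // => ? _; case: eqP.
have [xX|xX] := eqVneq x X; last first.
  by rewrite big1 // => Y' _; rewrite xpair_eqE eq_sym (negPf xX).
subst X.
have [zZ|zZ] := eqVneq Z' Z; last first.
  by rewrite big1 // => Y' _; rewrite xpair_eqE !eqseq_cons [Z == _]eq_sym
    (negPf zZ) !andbF.
subst Z.
have /and3P[xY YZ _] := ps.
rewrite (bigD1 Y) /=; last by rewrite !covers_lt.
rewrite eqxx big1 ?addr0 // => Y' /andP[_ /negPf Y'Y].
by rewrite xpair_eqE !eqseq_cons Y'Y andbF.
Qed.

(** The relation of [[Z, X]] is separated from the ideal generated by the others
    by its coefficients on the paths of length two from [X] to [Z]; shorter paths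
    are added to make the set of paths closed under factors. *)
Lemma two_path_sum_not_generated Z X (S : set (kQ k A)) :
  interval_length Z X = 2%N ->
  (forall u, S u -> u <> two_path_sum k Z X /\ exists Z' X' : lattice A,
     interval_length Z' X' = 2%N /\ u = two_path_sum k Z' X') ->
  ~ ideal_gen S (two_path_sum k Z X).
Proof.
move=> len hS.
pose K (p : qpath e) := (size p.2 <= 1)%N || [&& size p.2 == 2%N, qsrc p == X &
  qtgt p == Z].
have fK p q s : qcomp p q = Some s -> K s -> K p /\ K q.
  move=> pqs; have := qcompP p q; rewrite pqs => -[pq s1 s2].
  have es : qsrc s = qsrc q by [].
  have et : qtgt s = qtgt p by rewrite /qtgt s2 s1 last_cat -/(qtgt q) -pq.
  rewrite /K s2 size_cat es et => /orP[le1|/and3P[/eqP sz sX tZ]].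
    by rewrite (leq_trans (leq_addl _ _) le1) (leq_trans (leq_addr _ _) le1).
  case: (size q.2) (@size0nil _ q.2) sz => [|[|[|n]]] q0;
    rewrite ?addSn ?add0n // => sz.
  - rewrite sz /= pq /qtgt (q0 erefl) /= tZ.
    by split=> //; move: sX; rewrite /qsrc => ->.
  - by case: sz => ->.
  case: sz => /size0nil p0; rewrite p0 /= sX; split=> //.
  by move: tZ; rewrite /qtgt p0 /= -/(qsrc p) pq.
have [Y ZYX] := interval_length2_between len.
have [XY YZ] := interval_length2_covers len ZYX.
have ps : path e X [:: Y; Z] by rewrite /= XY YZ.
have SK : (S `<=` vanishing (fun p => K p))%classic.
  move=> u /hS[une [Z' [X' [len' uE]]]] p Kp; rewrite uE two_path_sum_coef //.
  case: (size p.2 =P 2%N) => //= p2; case: (qsrc p =P X') => //= pX'.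
  case: (qtgt p =P Z') => //= pZ'.
  move: Kp; rewrite /K p2 /= => /andP[/eqP pX /eqP pZ].
  by case: une; rewrite uE -pX' -pZ' pX pZ.
move=> /(smallest_sub (vanishing_ideal fK) SK)/(_ (@QPath _ e (X, [:: Y; Z]) ps)).
rewrite /K /qsrc /qtgt /= !eqxx => /(_ isT); rewrite two_path_sum_coef //= !eqxx /=.
by move/eqP; rewrite oner_eq0.
Qed.

End Relations.

Section Main.
Context {k : fieldType} {R : realType} {d : nat} {A : arrangement R d}.
Context {eps : lattice A -> seq 'rV[R]_d -> int}.
Hypothesis eps_orientation : forall X : lattice A, orientation (lspace X) (eps X).
Context {r : lattice A -> face A}.
Hypothesis supp_r : forall X : lattice A, supp (r X) = X.
Context {phi : {lrmorphism kQ k A -> kF k A}}.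
Hypothesis phi_vertex : forall X : lattice A, phi (qpathelt k X [::]) = idem k r X.
Hypothesis phi_arrow : forall X Y : lattice A, covers X Y ->
  phi (qpathelt k X [:: Y]) =
  idem k r Y * boundary eps (fbasis k (r Y)) * idem k r X.
Implicit Types (X Y Z W : lattice A).
Local Notation e := (fun X Y : lattice A => covers X Y).
Local Notation vt X := (qpathelt k X [::]).
Local Notation ar X Y := (qpathelt k X [:: Y]).
Local Notation relation_set := [set u : kQ k A | exists Z X : lattice A,
       interval_length Z X = 2%N /\ u = two_path_sum k Z X]%classic.

Lemma qvertexM X Y : vt X * vt Y = (if X == Y then vt X else 0) :> kQ k A.
Proof. exact: (@vtxM _ e k). Qed.

Lemma sum_qvertex : \sum_X vt X = 1 :> kQ k A.
Proof. exact: (@sum_vtx _ e k). Qed.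

Lemma idem_idem X : idem k r X * idem k r X = idem k r X.
Proof. by rewrite -phi_vertex -rmorphM qvertexM eqxx. Qed.

Lemma two_path_sum_ker Z X : interval_length Z X = 2%N ->
  phi (two_path_sum k Z X) = 0.
Proof.
move=> len; have [Y /andP[ZY YX]] := interval_length2_between len.
have cov Y' := interval_length2_covers (Y := Y') len.
rewrite /two_path_sum rmorph_sum /=.
rewrite (eq_bigr (fun Y => phi (ar Y Z) * phi (ar X Y))) => [|Y' /cov[XY YZ]];
  last first.
  by rewrite -rmorphM; congr (phi _); exact: qpathelt_comp.
rewrite -[RHS](@arrow_comp_sum _ _ _ _ r (fbasis k) (idem k r) supp_r (@fbasisM k
  R d A) (idemE k r) eps eps_orientation idem_idem Z X (lt_trans ZY YX));
    last 2 first.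
- by exists Y; rewrite ZY YX.
- exact: cov.
apply: eq_bigr => Y' /cov[XY YZ].
by rewrite !phi_arrow // !boundary_fbasis.
Qed.

Lemma two_path_sum_relation Z X : interval_length Z X = 2%N ->
  relations [set u : kQ k A | phi u = 0]%classic (two_path_sum k Z X).
Proof.
move=> len; split; first exact: two_path_sum_ker.
exists X, Z => p; rewrite -mcoeff_neq0 two_path_sum_coef //.
case c: (_ && _); last by rewrite eqxx.
by case/andP: c => /andP[_ /eqP ->] /eqP ->.
Qed.

Lemma ker_ideal : two_sided_ideal [set u : kQ k A | phi u = 0]%classic.
Proof.
split=> [|u v /= u0 v0|a u b /= u0]; first exact: rmorph0.
- by rewrite rmorphD /= u0 v0 addr0.
- by rewrite !rmorphM /= u0 mulr0 mul0r.
Qed.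

Lemma relation_two_path_sum W Y Z : covers W Y -> covers Y Z ->
  ideal_gen relation_set
    (\sum_(Y' : lattice A | (Z < Y' < W)%O) ar Y' Z * ar W Y' : kQ k A).
Proof.
move=> WY YZ; have len := covers_interval_length2 WY YZ.
have -> : \sum_(Y' : lattice A | (Z < Y' < W)%O) ar Y' Z * ar W Y' =
  two_path_sum k Z W.
  apply: eq_bigr => Y' /(interval_length2_covers len)[WY' Y'Z].
  by rewrite qpathelt_comp.
by apply: sub_gen_smallest; exists Z, W.
Qed.

Lemma ker_generated u : phi u = 0 -> ideal_gen relation_set u.
Proof.
apply: (@ker_sub_ideal k R d A (kQ k A) (kF k A) phi
  (fun X => vt X) (fun X Y => ar X Y)).
- exact: qvertexM.
- exact: sum_qvertex.
- exact: (@vtx_arr _ e k).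
- exact: (@arr_vtx _ e k).
- exact: (@vtx_decomp _ e k).
- move=> X Y v YX; apply: (@comp_eq0 _ e k) => s ps.
  by apply: contraNneq YX => <-; apply: path_covers_le.
- exact: ideal_gen_ideal.
- exact: relation_two_path_sum.
- by move=> v; apply: (smallest_sub ker_ideal) => _ [Z [X [len ->]]];
  apply: two_path_sum_ker.
- move=> c Z; rewrite phi_vertex => /eqP; rewrite scaler_eq0.
  by rewrite (negPf (idem_neq0 supp_r Z)) orbF => /eqP.
move=> Z i f iZ fE sum0 Y YZ iY.
have fE' Y' : idem k r Y' * f Y' = f Y' by rewrite -phi_vertex.
apply: (half_sum_eq0 supp_r (@fbasisM k R d A) (idemE k r) eps_orientation fE' iZ
  YZ iY).
apply: (fbasis_half_sum (P := fun x => [&& (r Z < x)%O, covers (supp x) Z & x i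
  != None])).
  by move=> x /and3P[].
rewrite -[RHS]sum0.
rewrite -[LHS](arrow_sum_faces supp_r (@fbasisM k R d A) (idemE k r)
  eps_orientation idem_idem fE').
by apply: eq_bigr => Y' /andP[Y'Z _]; rewrite phi_arrow // boundary_fbasis.
Qed.

End Main.

(** * Minimal relations *)

Theorem proposition8p5 (k : fieldType) (R : realType) (d : nat)
    (A : arrangement R d)
    (eps : lattice A -> seq 'rV[R]_d -> int)
    (eps_orientation : forall X : lattice A, orientation (lspace X) (eps X))
    (r : lattice A -> face A)
    (supp_r : forall X : lattice A, supp (r X) = X)
    (phi : {lrmorphism kQ k A -> kF k A})
    (phi_vertex : forall X : lattice A, phi (qpathelt k X [::]) = idem k r X)
    (phi_arrow : forall X Y : lattice A, covers X Y ->
       phi (qpathelt k X [:: Y]) =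
       idem k r Y * boundary eps (fbasis k (r Y)) * idem k r X) :
  (forall Z X : lattice A, interval_length Z X = 2%N ->
     phi (two_path_sum k Z X) = 0)
  /\
  minimal_generating_relations
    [set u : kQ k A | phi u = 0]%classic
    [set u : kQ k A | exists Z X : lattice A,
       interval_length Z X = 2%N /\ u = two_path_sum k Z X]%classic.
Proof.
have ker0 := two_path_sum_ker eps_orientation supp_r phi_vertex phi_arrow.
split; first exact: ker0.
split.
- move=> _ [Z [X [len ->]]].
  exact: (two_path_sum_relation eps_orientation supp_r phi_vertex phi_arrow).
- apply/seteqP; split.
    apply: (smallest_sub ker_ideal) => _ [Z [X [len ->]]]; exact: ker0.
  exact: (ker_generated eps_orientation supp_r phi_vertex phi_arrow).
move=> S' [S'S S'ne] gen; apply: S'ne => u [Z [X [len uE]]].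
apply: contrapT => S'u.
apply: (@two_path_sum_not_generated k R d A Z X S' len).
  move=> v S'v; split; last exact: S'S.
  by move=> vE; apply: S'u; rewrite uE -vE.
rewrite gen; exact: ker0.
Qed.
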